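(* There is an algorithm that, given a word $w$ and a stopwatch automaton $\mathbb{A}$ with bound $B_\mathbb{A}$, decides whether $w\in L(\mathbb{A})$ in time $O\big(\|\mathbb{A}\|^2\cdot B_\mathbb{A}\cdot|w|\big)$.
   Context: A (specific) stopwatch automaton is a tuple $\mathbb{A}=(Q,\Sigma,X,\lambda,\beta,\zeta,\Delta)$ where $Q$ is a finite set of states containing two distinguished states $\mathit{start}$ and $\mathit{accept}$; $\Sigma$ is a finite nonempty alphabet; $X$ is a finite set of stopwatches; $\lambda:Q\to\Sigma$; $\beta:X\to\mathbb{N}$ assigns each stopwatch its bound; $\zeta\subseteq X\times Q$ ($x$ is active in $q$ iff $(x,q)\in\zeta$); $\Delta$ is a finite set of transitions $(q,g,\alpha,q')$ with $g$ a guard and $\alpha$ an action. An assignment is $\xi:X\to\mathbb{N}$ with $\xi(x)\le\beta(x)$. Guards are Boolean circuits taking the binary encoding of an assignment (a block of $\lceil\log(\beta(x)+1)\rceil$ bits per stopwatch) and outputting one bit; actions are Boolean circuits mapping such encodings to encodings of numbers $v_x$, the resulting assignment being $x\mapsto\min\{v_x,\beta(x)\}$. Edges $(q,\xi)\stackrel{t}{\to}(q',\xi')$ between nodes (state, assignment): either $t=0$ and some $(q,g,\alpha,q')\in\Delta$ has $\xi$ satisfying $g$ and $\alpha(\xi)=\xi'$; or $t>0$, $q=q'$, and $\xi'(x)=\min\{\xi(x)+t,\beta(x)\}$ for $x$ active in $q$, $\xi'(x)=\xi(x)$ otherwise. A computation is a sequence $(q_0,\xi_0)\stackrel{t_0}{\to}\cdots\stackrel{t_{\ell-1}}{\to}(q_\ell,\xi_\ell)$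 with $q_i\ne\mathit{accept}$ for $i<\ell$; it is initial if $q_0=\mathit{start}$ and $\xi_0\equiv0$, accepting if $q_\ell=\mathit{accept}$, and reads $\lambda(q_0)^{t_0}\cdots\lambda(q_{\ell-1})^{t_{\ell-1}}$. $L(\mathbb{A})$ is the set of words read by initial accepting computations. The bound of $\mathbb{A}$ is $B_\mathbb{A}=\prod_{x\in X}(\beta(x)+1)$, and $\|\mathbb{A}\|$ is the length of a reasonable binary encoding of $\mathbb{A}$.
   Formalization: The factor |w| in the time bound is read as max(1,|w|), since for the empty word the literal bound would be 0, which no algorithm can meet; time is the number of instructions of a uniform-cost RAM without multiplication. *)

(* Defs.v *)
From HB Require Import structures.
From Stdlib Require List.
From mathcomp Require Import all_boot.

Set Implicit Arguments.
Unset Strict Implicit.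
Unset Printing Implicit Defensive.

(** * Binary numerals, least significant bit first *)

Fixpoint bits (k n : nat) : seq bool :=
  if k is k'.+1 then odd n :: bits k' n./2 else [::].

Definition bits_val (s : seq bool) : nat :=
  foldr (fun (b : bool) v => b + v.*2) 0 s.

(* [up_log 2 n.+1] is the ceiling of log2 (n + 1): the number of binary digits
   of n, and 0 for n = 0. *)
Definition width (n : nat) : nat := up_log 2 n.+1.

(** * Boolean circuits *)

(* A circuit with n inputs is a straight-line program: wires 0, ..., n-1 are the
   inputs, gate number k drives wire n + k and reads wires of smaller index. *)
Variant gate : Type :=
  | GConst of bool
  | GNot of nat
  | GAnd of nat & nat
  | GOr of nat & nat.

Definition gate_ok (n : nat) (g : gate) : bool :=
  match g with
  | GConst _ => true
  | GNot i => i < n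
  | GAnd i j | GOr i j => (i < n) && (j < n)
  end.

Fixpoint gates_ok (n : nat) (gs : seq gate) : bool :=
  if gs is g :: gs' then gate_ok n g && gates_ok n.+1 gs' else true.

Record circuit (n m : nat) : Type := Circuit {
  gates : seq gate;
  outs : m.-tuple nat;
  gates_wf : gates_ok n gates;
  outs_wf : all (fun i => i < n + size gates) outs
}.

Definition eval_gate (v : seq bool) (g : gate) : bool :=
  match g with
  | GConst b => b
  | GNot i => ~~ nth false v i
  | GAnd i j => nth false v i && nth false v j
  | GOr i j => nth false v i || nth false v j
  end.

Fixpoint eval_gates (v : seq bool) (gs : seq gate) : seq bool :=
  if gs is g :: gs' then eval_gates (rcons v (eval_gate v g)) gs' else v.

Definition eval_circuit n m (C : circuit n m) (v : seq bool) : seq bool :=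
  [seq nth false (eval_gates v (gates C)) i | i <- outs C].

(** * Stopwatch automata *)

Definition block_widths nx (beta : {ffun 'I_nx -> nat}) : seq nat :=
  [seq width (beta x) | x <- enum 'I_nx].

Record transition nq nx (beta : {ffun 'I_nx -> nat}) : Type := Transition {
  source : 'I_nq;
  guard : circuit (sumn (block_widths beta)) 1;
  action : circuit (sumn (block_widths beta)) (sumn (block_widths beta));
  target : 'I_nq
}.

(* States, letters and stopwatches are numbered.  The alphabet is nonempty
   because [label start] is a letter. *)
Record automaton : Type := Automaton {
  nstates : nat;
  nletters : nat;
  nwatches : nat;
  start : 'I_nstates;
  accept : 'I_nstates;
  label : {ffun 'I_nstates -> 'I_nletters};
  beta : {ffun 'I_nwatches -> nat};
  active : {set 'I_nwatches * 'I_nstates};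
  transitions : seq (transition nstates beta)
}.

Definition bound (A : automaton) : nat := \prod_(x < nwatches A) (beta A x).+1.

Section Semantics.
Variable A : automaton.

Definition assignment : Type :=
  {dffun forall x : 'I_(nwatches A), 'I_(beta A x).+1}.

Definition node : Type := ('I_(nstates A) * assignment)%type.

(* [inord] never sees an out-of-range value here. *)
Definition clip (v : 'I_(nwatches A) -> nat) : assignment :=
  [ffun x : 'I_(nwatches A) => inord (minn (v x) (beta A x)) : 'I_(beta A x).+1].

Definition zero_assignment : assignment := clip (fun=> 0).

Definition encode_assignment (xi : assignment) : seq bool :=
  flatten [seq bits (width (beta A x)) (xi x) | x <- enum 'I_(nwatches A)].

Definition satisfies (xi : assignment)
    (g : circuit (sumn (block_widths (beta A))) 1) : bool :=
  head false (eval_circuit g (encode_assignment xi)).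

Definition act
    (a : circuit (sumn (block_widths (beta A))) (sumn (block_widths (beta A))))
    (xi : assignment) : assignment :=
  let blocks := reshape (block_widths (beta A))
                        (eval_circuit a (encode_assignment xi)) in
  clip (fun x => bits_val (nth [::] blocks x)).

Definition elapse (q : 'I_(nstates A)) (t : nat) (xi : assignment) : assignment :=
  clip (fun x => if (x, q) \in active A then xi x + t else xi x).

Inductive edge : node -> nat -> node -> Prop :=
  | EdgeTransition (d : transition (nstates A) (beta A)) (xi : assignment) :
      List.In d (transitions A) -> satisfies xi (guard d) ->
      edge (source d, xi) 0 (target d, act (action d) xi)
  | EdgeTime (q : 'I_(nstates A)) (xi : assignment) (t : nat) :
      0 < t -> edge (q, xi) t (q, elapse q t xi).

(* [computation s w s']: some computation from s to s' reads w. *)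
Inductive computation : node -> seq 'I_(nletters A) -> node -> Prop :=
  | CompNil (s : node) : computation s [::] s
  | CompCons (s s' s'' : node) (t : nat) (u : seq 'I_(nletters A)) :
      s.1 != accept A -> edge s t s' -> computation s' u s'' ->
      computation s (nseq t (label A s.1) ++ u) s''.

Definition language (w : seq 'I_(nletters A)) : Prop :=
  exists xi : assignment,
    computation (start A, zero_assignment) w (accept A, xi).

End Semantics.

Arguments language A w : clear implicits.

(** * Binary encodings *)

(* Self-delimiting code: every binary digit is preceded by a 1, and a 0 ends the
   number. *)
Definition encode_nat (n : nat) : seq bool :=
  flatten [seq [:: true; b] | b <- bits (width n) n] ++ [:: false].

Definition encode_nats (s : seq nat) : seq bool := flatten (map encode_nat s).

Definition code_gate (g : gate) : seq nat :=
  match g with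
  | GConst b => [:: 0; nat_of_bool b; 0]
  | GNot i => [:: 1; i; 0]
  | GAnd i j => [:: 2; i; j]
  | GOr i j => [:: 3; i; j]
  end.

Definition code_circuit n m (C : circuit n m) : seq nat :=
  size (gates C) :: flatten (map code_gate (gates C)) ++ m :: outs C.

Definition code_transition nq nx (beta : {ffun 'I_nx -> nat})
    (d : transition nq beta) : seq nat :=
  [:: nat_of_ord (source d); nat_of_ord (target d)]
    ++ code_circuit (guard d) ++ code_circuit (action d).

Definition code_automaton (A : automaton) : seq nat :=
  [:: nstates A; nletters A; nwatches A;
      nat_of_ord (start A); nat_of_ord (accept A)]
    ++ [seq nat_of_ord (label A q) | q <- enum 'I_(nstates A)]
    ++ [seq beta A x | x <- enum 'I_(nwatches A)]
    ++ (#|active A| ::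
          flatten [seq [:: nat_of_ord p.1; nat_of_ord p.2] | p <- enum (active A)])
    ++ (size (transitions A) :: flatten (map (@code_transition _ _ _) (transitions A))).

Definition encode_automaton (A : automaton) : seq bool :=
  encode_nats (code_automaton A).

Definition automaton_size (A : automaton) : nat := size (encode_automaton A).

Definition encode_word n (w : seq 'I_n) : seq bool :=
  encode_nats (size w :: map (@nat_of_ord n) w).

(** * Random access machines *)

(* The uniform-cost RAM of Cook and Reckhow with natural-number registers and a
   one-way read-only input tape.  There is deliberately no multiplication: with
   it, counting instructions would no longer be a reasonable time measure. *)
Variant instr : Type :=
  | IConst (r c : nat)      (* R[r] := c *)
  | IAdd (r a b : nat)      (* R[r] := R[a] + R[b] *)
  | ISub (r a b : nat)      (* R[r] := R[a] - R[b], truncated at 0 *)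
  | ILoad (r a : nat)       (* R[r] := R[R[a]] *)
  | IStore (a r : nat)      (* R[R[a]] := R[r] *)
  | IRead (r : nat)         (* R[r] := next input bit, 0 past the end *)
  | IJump (l : nat)
  | IJumpZero (r l : nat)   (* jump to l if R[r] = 0 *)
  | IAccept
  | IReject.

Definition program : Type := seq instr.

Record config : Type := Config {
  pc : nat;
  regs : nat -> nat;
  input : seq bool
}.

Definition update (R : nat -> nat) (r v : nat) : nat -> nat :=
  fun k => if k == r then v else R k.

Definition step (i : instr) (c : config) : config :=
  let: Config p R s := c in
  match i with
  | IConst r v => Config p.+1 (update R r v) s
  | IAdd r a b => Config p.+1 (update R r (R a + R b)) s
  | ISub r a b => Config p.+1 (update R r (R a - R b)) s
  | ILoad r a => Config p.+1 (update R r (R (R a))) s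
  | IStore a r => Config p.+1 (update R (R a) (R r)) s
  | IRead r => Config p.+1 (update R r (head false s)) (behead s)
  | IJump l => Config l R s
  | IJumpZero r l => Config (if R r == 0 then l else p.+1) R s
  | IAccept | IReject => c
  end.

(* [run P t c = Some b]: from configuration c, program P halts after executing
   at most t instructions, with answer b.  Leaving the program rejects. *)
Fixpoint run (P : program) (t : nat) (c : config) : option bool :=
  if t is t'.+1 then
    match nth IReject P (pc c) with
    | IAccept => Some true
    | IReject => Some false
    | i => run P t' (step i c)
    end
  else None.

Definition initial_config (s : seq bool) : config := Config 0 (fun=> 0) s.

(* Main.v *)
(** The machine explores, letter by letter, the nodes (state, assignment) reachable
    after reading a prefix of the word.  A time edge of length [t] is a sequence of
    unit time edges, so one layer is obtained from the previous one by unit time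
    steps out of states labelled by the current letter, followed by a worklist
    closure under transitions; accepting nodes are never expanded and only raise a
    flag.  A node is expanded at most once per layer, which costs [O(|A|)] plus
    [O(|X|)] per transition leaving its state.  There are [|Q| B_A] nodes, and a
    transition leaves [B_A] of them, whence [O(|A|^2 B_A)] per layer.

    Memory is never cleared: visited nodes are marked with the number of the layer at
    an address that encodes the node injectively, and the worklist is append-only.
    Since the machine can neither multiply nor divide, binary digits are extracted
    with a table of halves, of length at most [B_A]. *)

Require Import Defs.
From Stdlib Require List.
From mathcomp Require Import all_boot zify.

Set Implicit Arguments.
Unset Strict Implicit.
Unset Printing Implicit Defensive.

(** Counting instructions of hand-written machine code would drown the argument. The algorithm is
    therefore written in a small language with loops, numbered variables and arrays, whose states
    carry a clock; its compiler spends at most 8 machine instructions per clock tick. Every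
    specification bounds the clock along with the result, so that the running time becomes a closed
    formula to be estimated by arithmetic.

    The delicate cost is that of the stopwatches. A stopwatch of bound 0 occupies no bit, so
    [nwatches A] is not bounded by the length of a transition, and visiting all stopwatches for
    every pair of node and transition would cost states times stopwatches times transitions, which
    is cubic in the size of the automaton. Hence a new assignment is decoded only after source and
    guard have been tested. The circuits, in contrast, may be evaluated for every such pair, since
    the lengths of all transitions add up to at most the size of the automaton. *)

(** * A language of while programs with a clock *)

Definition upd (T : Type) (f : nat -> T) (k : nat) (v : T) : nat -> T :=
  fun i => if Nat.eqb i k then v else f i.

Arguments upd T f k v i : simpl nomatch.

Lemma upd_same T (f : nat -> T) k v : upd f k v k = v.
Proof. by rewrite /upd PeanoNat.Nat.eqb_refl. Qed.

Lemma upd_other T (f : nat -> T) k v i : i <> k -> upd f k v i = f i.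
Proof. by rewrite /upd; case: PeanoNat.Nat.eqb_spec. Qed.

Variant basic : Type :=
  | BSet (x n : nat)
  | BAddc (x y n : nat)
  | BSubc (x y n : nat)
  | BAdd (x y z : nat)
  | BSub (x y z : nat)
  | BGet (x a y : nat)
  | BPut (a y x : nat)
  | BRead (x : nat).

Inductive cmd : Type :=
  | Do (l : seq basic)
  | Seq (c1 c2 : cmd)
  | If (x : nat) (c1 c2 : cmd)
  | While (x : nat) (c : cmd).

Record state : Type := St {
  vars : nat -> nat;
  arr : nat -> nat -> nat;
  inp : seq bool;
  clk : nat
}.

Definition tick (s : state) : state := St (vars s) (arr s) (inp s) (clk s).+1.

Definition bstep (s : state) (b : basic) : state :=
  let V := vars s in let M := arr s in let i := inp s in let t := (clk s).+1 in
  match b with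
  | BSet x n => St (upd V x n) M i t
  | BAddc x y n => St (upd V x (V y + n)) M i t
  | BSubc x y n => St (upd V x (V y - n)) M i t
  | BAdd x y z => St (upd V x (V y + V z)) M i t
  | BSub x y z => St (upd V x (V y - V z)) M i t
  | BGet x a y => St (upd V x (M a (V y))) M i t
  | BPut a y x => St V (upd M a (upd (M a) (V y) (V x))) i t
  | BRead x => St (upd V x (head false i)) M (behead i) t
  end.

Inductive exec : cmd -> state -> state -> Prop :=
  | ExDo l s : exec (Do l) s (foldl bstep s l)
  | ExSeq c1 c2 s s1 s2 : exec c1 s s1 -> exec c2 s1 s2 -> exec (Seq c1 c2) s s2
  | ExIfT x c1 c2 s s' :
      vars s x <> 0 -> exec c1 (tick s) s' -> exec (If x c1 c2) s s'
  | ExIfF x c1 c2 s s' :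
      vars s x = 0 -> exec c2 (tick s) s' -> exec (If x c1 c2) s s'
  | ExWhileT x c s s1 s2 :
      vars s x <> 0 -> exec c (tick s) s1 -> exec (While x c) s1 s2 ->
      exec (While x c) s s2
  | ExWhileF x c s : vars s x = 0 -> exec (While x c) s (tick s).

(** * Compilation to the RAM *)

(* Variable [x] lives at address [8 x] and cell [i] of array [a] at [8 i + a]
   for [0 < a < 7]; addresses 7 and 15 are scratch. *)
Definition var_reg (x : nat) : nat := x * 8.

Definition addr_code (a y : nat) : seq instr :=
  [:: IAdd 7 (var_reg y) (var_reg y); IAdd 7 7 7; IAdd 7 7 7; IConst 15 a;
      IAdd 7 7 15].

Definition compile_basic (b : basic) : seq instr :=
  match b with
  | BSet x n => [:: IConst (var_reg x) n]
  | BAddc x y n => [:: IConst 15 n; IAdd (var_reg x) (var_reg y) 15]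
  | BSubc x y n => [:: IConst 15 n; ISub (var_reg x) (var_reg y) 15]
  | BAdd x y z => [:: IAdd (var_reg x) (var_reg y) (var_reg z)]
  | BSub x y z => [:: ISub (var_reg x) (var_reg y) (var_reg z)]
  | BGet x a y => addr_code a y ++ [:: ILoad (var_reg x) 7]
  | BPut a y x => addr_code a y ++ [:: IStore 7 (var_reg x)]
  | BRead x => [:: IRead (var_reg x)]
  end.

Fixpoint code_size (c : cmd) : nat :=
  match c with
  | Do l => size (flatten (map compile_basic l))
  | Seq c1 c2 => code_size c1 + code_size c2
  | If _ c1 c2 => (code_size c1 + code_size c2).+2
  | While _ c => (code_size c).+2
  end.

Fixpoint compile (p : nat) (c : cmd) : seq instr :=
  match c with
  | Do l => flatten (map compile_basic l)
  | Seq c1 c2 => compile p c1 ++ compile (p + code_size c1) c2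
  | If x c1 c2 =>
      IJumpZero (var_reg x) (p + (code_size c1).+2) ::
      compile p.+1 c1 ++
      IJump (p + (code_size c1 + code_size c2).+2) ::
      compile (p + (code_size c1).+2) c2
  | While x c1 =>
      IJumpZero (var_reg x) (p + (code_size c1).+2) ::
      compile p.+1 c1 ++ [:: IJump p]
  end.

Definition basic_ok (b : basic) : bool :=
  match b with
  | BGet _ a _ | BPut a _ _ => 0 < a < 7
  | _ => true
  end.

Fixpoint cmd_ok (c : cmd) : bool :=
  match c with
  | Do l => all basic_ok l
  | Seq c1 c2 | If _ c1 c2 => cmd_ok c1 && cmd_ok c2
  | While _ c => cmd_ok c
  end.

Lemma size_compile p c : size (compile p c) = code_size c.
Proof.
elim: c p => [l|c1 IH1 c2 IH2|x c1 IH1 c2 IH2|x c IH] p //=.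
- by rewrite size_cat IH1 IH2.
- by rewrite size_cat /= IH1 IH2 addnS.
- by rewrite size_cat /= IH addn1.
Qed.

Definition code_at (P : program) (p : nat) (l : seq instr) : Prop :=
  forall i, i < size l -> nth IReject P (p + i) = nth IReject l i.

Lemma code_at_cat P p l1 l2 :
  code_at P p (l1 ++ l2) -> code_at P p l1 /\ code_at P (p + size l1) l2.
Proof.
move=> H; split=> i Hi.
  by rewrite H ?nth_cat ?Hi // size_cat ltn_addr.
by rewrite -addnA H ?nth_cat ?size_cat ?ltn_add2l // ltnNge leq_addr /= addKn.
Qed.

Lemma code_at_cons P p i l :
  code_at P p (i :: l) -> nth IReject P p = i /\ code_at P p.+1 l.
Proof.
move=> H; split; first by have := H 0 isT; rewrite addn0.
by move=> j Hj; have := H j.+1 Hj; rewrite addnS.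
Qed.

(** An equation for all remaining fuel [t]: such equations compose by adding the fuels, and nothing
    has to be said about halting. *)
Definition steps (P : program) (n : nat) (k k' : config) : Prop :=
  forall t, run P (n + t) k = run P t k'.

Lemma steps_trans P n1 n2 k1 k2 k3 :
  steps P n1 k1 k2 -> steps P n2 k2 k3 -> steps P (n1 + n2) k1 k3.
Proof. by move=> H1 H2 t; rewrite -addnA H1 H2. Qed.

Definition simulates (s : state) (k : config) : Prop :=
  [/\ forall x, regs k (var_reg x) = vars s x,
      forall a i, 0 < a < 7 -> regs k (i * 8 + a) = arr s a i
    & input k = inp s].

Definition nonhalting (i : instr) : bool :=
  match i with IAccept | IReject => false | _ => true end.

Lemma steps1 P i k : nth IReject P (pc k) = i -> nonhalting i ->
  steps P 1 k (step i k).
Proof. by move=> E Hi t; rewrite add1n /= E; case: i Hi E. Qed.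

Fixpoint exec_line (l : seq instr) (k : config) : config :=
  if l is i :: l' then exec_line l' (step i k) else k.

Definition straight (i : instr) : bool :=
  match i with
  | IAccept | IReject | IJump _ | IJumpZero _ _ => false
  | _ => true
  end.

Lemma pc_step i k : straight i -> pc (step i k) = (pc k).+1.
Proof. by case: k => p R s; case: i. Qed.

Lemma steps_line P l k : all straight l -> code_at P (pc k) l ->
  steps P (size l) k (exec_line l k) /\ pc (exec_line l k) = pc k + size l.
Proof.
elim: l k => [|i l IH] k /=; first by rewrite addn0.
case/andP=> Hi Hl /code_at_cons [E H].
have Ek := pc_step k Hi.
have [|H1 H2] := IH (step i k) Hl; first by rewrite Ek.
split; last by rewrite H2 Ek addSnnS.
have Ni : nonhalting i by clear -Hi; case: i Hi.
by rewrite -add1n; apply: steps_trans H1; apply: steps1.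
Qed.

Lemma simulates_scratch s p k k' :
  simulates s k ->
  (forall r, r <> 7 -> r <> 15 -> regs k' r = regs k r) -> input k' = input k ->
  simulates s (Config p (regs k') (input k')).
Proof.
case=> H1 H2 H3 H E; split=> /= [x|a i Ha|]; last by rewrite E.
  by rewrite H ?H1 // /var_reg; lia.
by rewrite H ?H2 //; lia.
Qed.

Lemma simulates_set s k p t x v j :
  simulates s k ->
  simulates (St (upd (vars s) x v) (arr s) j t)
            (Config p (update (regs k) (var_reg x) v) j).
Proof.
case=> H1 H2 H3; split=> //= [y|a i Ha]; rewrite /update /upd.
  rewrite H1 /var_reg eqn_mul2r /=.
  by case: PeanoNat.Nat.eqb_spec => [->|/eqP/negPf->]; rewrite ?eqxx.
by rewrite -(H2 a i Ha) /var_reg; case: eqP => // E; exfalso; lia.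
Qed.

Lemma simulates_put s k p t a i v j : 0 < a < 7 ->
  simulates s k ->
  simulates (St (vars s) (upd (arr s) a (upd (arr s a) i v)) j t)
            (Config p (update (regs k) (i * 8 + a) v) j).
Proof.
move=> Ha [H1 H2 H3]; split=> //= [y|a' i' Ha']; rewrite /update /upd.
  by rewrite -H1 /var_reg; case: eqP => // E; exfalso; lia.
case: PeanoNat.Nat.eqb_spec => [->|N]; last first.
  by rewrite -(H2 a' i' Ha'); case: eqP => // E; exfalso; lia.
rewrite -(H2 _ _ Ha) eqn_add2r eqn_mul2r /=.
by case: PeanoNat.Nat.eqb_spec => [->|/eqP/negPf->]; rewrite ?eqxx.
Qed.

(** Reduces code that passes through the scratch registers to a single register update. The counter
    [p] is free because [simulates] ignores it. *)
Lemma simulates_line k p R s :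
  simulates s (Config p R (input k)) ->
  (forall r, r <> 7 -> r <> 15 -> regs k r = R r) ->
  simulates s k.
Proof.
move=> H E; have := @simulates_scratch s (pc k) _ k H E erefl.
by case: k {H E}.
Qed.

Lemma var_reg_scratch y : ((var_reg y == 7) = false) * ((var_reg y == 15) = false).
Proof. by rewrite /var_reg; split; apply/eqP; lia. Qed.

Lemma compile_basic_correct b s k : basic_ok b -> simulates s k ->
  simulates (bstep s b) (exec_line (compile_basic b) k).
Proof.
case: s k => V M i t [p R j] Hb Hs; have [/= H1 H2 H3] := Hs; subst j.
have set_var x v q j : simulates (St (upd V x v) M j t.+1)
    (Config q (update R (var_reg x) v) j) := simulates_set _ _ _ _ _ Hs.
have line := @simulates_line (exec_line (compile_basic b) (Config p R i)) 0.
case: b line Hb => [x n|x y n|x y n|x y z|x y z|x a y|a y x|x] line /= Hb.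
- exact: set_var.
- apply: line (set_var _ _ _ _) _ => r N7 N15.
  by rewrite /= /update !var_reg_scratch /= H1; do 2 case: eqP => //.
- apply: line (set_var _ _ _ _) _ => r N7 N15.
  by rewrite /= /update !var_reg_scratch /= H1; do 2 case: eqP => //.
- by rewrite /= !H1; exact: set_var.
- by rewrite /= !H1; exact: set_var.
- apply: line (set_var _ _ _ _) _ => r N7 N15.
  rewrite /= /update /= H1.
  have -> : V y + V y + (V y + V y) + (V y + V y + (V y + V y)) + a = V y * 8 + a.
    by lia.
  rewrite -(H2 _ _ Hb).
  by repeat (case: eqP => //= ?; try (exfalso; lia)).
- apply: line (simulates_put 0 t.+1 (V y) (V x) i Hb Hs) _ => r N7 N15.
  rewrite /= /update !var_reg_scratch /= !H1.
  have -> : V y + V y + (V y + V y) + (V y + V y + (V y + V y)) + a = V y * 8 + a.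
    by lia.
  by repeat (case: eqP => //= ?; try (exfalso; lia)).
- exact: set_var.
Qed.

Lemma straight_compile l : all straight (flatten (map compile_basic l)).
Proof. by elim: l => // b l IH; rewrite /= all_cat IH andbT; case: b. Qed.

Lemma exec_line_cat l1 l2 k : exec_line (l1 ++ l2) k = exec_line l2 (exec_line l1 k).
Proof. by elim: l1 k => //= i l1 IH k. Qed.

Lemma size_compile_basics l : size (flatten (map compile_basic l)) <= 8 * size l.
Proof.
elim: l => // b l IH; rewrite /= size_cat mulnS leq_add //.
by case: b.
Qed.

Lemma clk_basics l s : clk (foldl bstep s l) = clk s + size l.
Proof.
elim: l s => [|b l IH] s /=; first by rewrite addn0.
by rewrite IH addnS -addSn; case: s => V M i t; case: b.
Qed.

Lemma compile_basics_correct l s k : all basic_ok l -> simulates s k ->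
  simulates (foldl bstep s l) (exec_line (flatten (map compile_basic l)) k).
Proof.
elim: l s k => // b l IH s k /= /andP [Hb Hl] Hs.
by rewrite exec_line_cat; apply: IH => //; exact: compile_basic_correct.
Qed.

(** The factor 8 is generous: a basic command becomes at most 6 instructions (5 to compute an
    address, 1 to access it), and a test with its jump becomes 2. The induction is on the execution,
    so that one iteration of a loop and the remaining ones use the same code at [p]. *)
Lemma compile_correct c s s' : exec c s s' -> cmd_ok c ->
  forall P p k, code_at P p (compile p c) -> pc k = p -> simulates s k ->
  exists n k', [/\ n + 8 * clk s <= 8 * clk s', pc k' = p + code_size c,
                   simulates s' k' & steps P n k k'].
Proof.
elim=> {c s s'}.
- move=> l s /= Hl P p k HP Ep Hs; subst p.
  have [H1 H2] := steps_line (straight_compile l) HP.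
  exists (size (flatten (map compile_basic l))), (exec_line (flatten (map compile_basic l)) k).
  split=> //; last exact: compile_basics_correct.
  by rewrite clk_basics mulnDr addnC leq_add2l size_compile_basics.
- move=> c1 c2 s s1 s2 _ IH1 _ IH2 /= /andP [ok1 ok2] P p k.
  case/code_at_cat => HP1; rewrite size_compile => HP2 Ep Hs.
  have [n1 [k1 [L1 E1 S1 T1]]] := IH1 ok1 P p k HP1 Ep Hs.
  have [n2 [k2 [L2 E2 S2 T2]]] := IH2 ok2 P _ k1 HP2 E1 S1.
  exists (n1 + n2), k2; split=> //; [lia|by rewrite E2 addnA|exact: steps_trans T2].
- move=> x c1 c2 s s' Hx _ IH /= /andP [ok1 ok2] P p k.
  case/code_at_cons => HP0 /code_at_cat [HP1]; rewrite size_compile.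
  case/code_at_cons => HPj _ Ep Hs.
  have Hx' : regs k (var_reg x) <> 0 by have [-> _ _] := Hs.
  have [] := IH ok1 P p.+1 (Config p.+1 (regs k) (input k)) HP1 erefl.
    by case: Hs => *; split.
  move=> n [k1 [L1 E1 S1 T1]].
  exists (1 + (n + 1)), (Config (p + (code_size c1 + code_size c2).+2) (regs k1) (input k1)).
  split=> //; first by move: L1 => /=; lia.
  apply: steps_trans (steps_trans T1 _).
    have := @steps1 P _ k; rewrite Ep => /(_ _ HP0 isT); case: (k) Ep Hx' => p0 R0 i0 /= -> /eqP/negPf ->.
    by [].
  have := @steps1 P _ k1; rewrite E1 => /(_ _ HPj isT).
  by case: (k1).
- move=> x c1 c2 s s' Hx _ IH /= /andP [ok1 ok2] P p k.
  case/code_at_cons => HP0 /code_at_cat [HP1]; rewrite size_compile.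
  case/code_at_cons => HPj HP2 Ep Hs.
  have Hx' : regs k (var_reg x) = 0 by have [-> _ _] := Hs.
  have Eq : (p.+1 + code_size c1).+1 = p + (code_size c1).+2 by lia.
  rewrite Eq in HP2.
  have [] := IH ok2 P _ (Config (p + (code_size c1).+2) (regs k) (input k)) HP2 erefl.
    by case: Hs => *; split.
  move=> n [k1 [L1 E1 S1 T1]].
  exists (1 + n), k1; split=> //; [by move: L1 => /=; lia|by rewrite E1; lia|].
  apply: steps_trans T1.
  have := @steps1 P _ k; rewrite Ep => /(_ _ HP0 isT); case: (k) Ep Hx' => p0 R0 i0 /= -> ->.
  by [].
- move=> x c s s1 s2 Hx _ IH1 _ IH2 /= ok P p k HP Ep Hs.
  have /code_at_cons [HP0 /code_at_cat [HP1]] := HP; rewrite size_compile.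
  case/code_at_cons => HPj _.
  have Hx' : regs k (var_reg x) <> 0 by have [-> _ _] := Hs.
  have [] := IH1 ok P p.+1 (Config p.+1 (regs k) (input k)) HP1 erefl.
    by case: Hs => *; split.
  move=> n1 [k1 [L1 E1 S1 T1]].
  have [] := IH2 ok P p (Config p (regs k1) (input k1)) HP erefl.
    by case: S1 => *; split.
  move=> n2 [k2 [L2 E2 S2 T2]].
  exists (1 + (n1 + (1 + n2))), k2; split=> //; first by move: L1 => /=; lia.
  apply: steps_trans (steps_trans T1 (steps_trans _ T2)).
    have := @steps1 P _ k; rewrite Ep => /(_ _ HP0 isT); case: (k) Ep Hx' => p0 R0 i0 /= -> /eqP/negPf ->.
    by [].
  have := @steps1 P _ k1; rewrite E1 => /(_ _ HPj isT).
  by case: (k1).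
- move=> x c s Hx /= ok P p k /code_at_cons [HP0 _] Ep Hs.
  have Hx' : regs k (var_reg x) = 0 by have [-> _ _] := Hs.
  exists 1, (Config (p + (code_size c).+2) (regs k) (input k)).
  split=> //; first by move=> /=; lia.
  have := @steps1 P _ k; rewrite Ep => /(_ _ HP0 isT); case: (k) Ep Hx' => p0 R0 i0 /= -> ->.
  by [].
Qed.

Definition init_state (i : seq bool) : state := St (fun=> 0) (fun _ _ => 0) i 0.

(* The answer of [c] is left in variable 0. *)
Definition compile_program (c : cmd) : program :=
  compile 0 c ++ [:: IJumpZero 0 (code_size c).+2; IAccept; IReject].

Lemma compile_program_correct c i s' : cmd_ok c -> exec c (init_state i) s' ->
  forall t, 8 * clk s' + 2 <= t ->
  run (compile_program c) t (initial_config i) = Some (vars s' 0 != 0).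
Proof.
move=> ok Hex t Ht.
have HP : code_at (compile_program c) 0 (compile_program c) by [].
have [HP1] := code_at_cat HP; rewrite size_compile add0n => HP2.
have [||n [k [Ln Ek Sk Tk]]] := compile_correct Hex ok HP1 (k := initial_config i) => //.
case/code_at_cons: HP2 => Q0 /code_at_cons [Q1 /code_at_cons [Q2 _]].
rewrite /= in Ln.
(* Two instructions remain after the code of [c]: the test of variable 0 and the halting
   instruction. *)
have [m Em] : exists m, t = n + m.+2 by exists (t - n - 2); lia.
rewrite {}Em Tk /= Ek add0n Q0.
have [Hv _ _] := Sk; have := Hv 0; rewrite /var_reg mul0n => E0.
case: k {Tk Sk Hv} Ek E0 => p R j /= -> ->.
by case: eqP => _; rewrite ?Q1 ?Q2.
Qed.

(** * Total correctness *)

Definition wp (c : cmd) (s : state) (Q : state -> Prop) : Prop :=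
  exists2 s', exec c s s' & Q s'.

Lemma wp_do l s (Q : state -> Prop) : Q (foldl bstep s l) -> wp (Do l) s Q.
Proof. by move=> H; exists (foldl bstep s l) => //; constructor. Qed.

Lemma wp_seq c1 c2 s Q : wp c1 s (fun s' => wp c2 s' Q) -> wp (Seq c1 c2) s Q.
Proof. by case=> s1 H1 [s2 H2 HQ]; exists s2 => //; apply: ExSeq H2. Qed.

Lemma wp_if x c1 c2 s Q :
  (vars s x <> 0 -> wp c1 (tick s) Q) -> (vars s x = 0 -> wp c2 (tick s) Q) ->
  wp (If x c1 c2) s Q.
Proof.
move=> H1 H2; case: (eqVneq (vars s x) 0) => [E|/eqP E].
  by have [s' He HQ] := H2 E; exists s' => //; exact: ExIfF.
by have [s' He HQ] := H1 E; exists s' => //; exact: ExIfT.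
Qed.

Lemma wp_while_step x c s Q :
  vars s x <> 0 -> wp c (tick s) (fun s' => wp (While x c) s' Q) ->
  wp (While x c) s Q.
Proof. by move=> Hx [s1 H1 [s2 H2 HQ]]; exists s2 => //; exact: ExWhileT H2. Qed.

Lemma wp_while_done x c s (Q : state -> Prop) :
  vars s x = 0 -> Q (tick s) -> wp (While x c) s Q.
Proof. by move=> Hx HQ; exists (tick s) => //; exact: ExWhileF. Qed.

Lemma wp_mono c s (Q Q' : state -> Prop) :
  wp c s Q -> (forall s', Q s' -> Q' s') -> wp c s Q'.
Proof. by case=> s' He HQ H; exists s' => //; exact: H. Qed.

Definition frame (T : Type) (L : seq nat) (f g : nat -> T) : Prop :=
  forall v, v \notin L -> g v = f v.

Lemma frame_refl T L (f : nat -> T) : frame L f f.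
Proof. by []. Qed.

Lemma frame_upd T L (f g : nat -> T) n x :
  n \in L -> frame L f g -> frame L f (upd g n x).
Proof.
by move=> Hn H v Hv; rewrite upd_other ?H // => E; rewrite -E (negPf Hv) in Hn.
Qed.

Lemma frame_trans T L L' (f g h : nat -> T) :
  frame L' g h -> all (mem L) L' -> frame L f g -> frame L f h.
Proof.
move=> H /allP HL Hf v Hv; rewrite H ?Hf //.
by apply: contra Hv => /HL.
Qed.

(** [Lv] and [La] list the variables and arrays that may have been written, [i] is the input that is
    left, and [t] is the time allowed. *)
Record extends (Lv La : seq nat) (s s' : state) (i : seq bool) (t : nat) : Prop :=
  Extends {
    frame_vars : frame Lv (vars s) (vars s');
    frame_arr : frame La (arr s) (arr s');
    inp_eq : inp s' = i;
    clk_le : clk s' <= clk s + t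
  }.

(** Variables and arrays are literal numerals and [upd] compares with [Nat.eqb], so lookups are
    decided by computation; in [frames], so is membership in a list of written variables, whence
    [isT]. *)
Ltac ev := cbn [upd Nat.eqb vars arr inp clk tick foldl bstep].

Ltac ev_all := cbn [upd Nat.eqb vars arr inp clk tick foldl bstep] in *.

Ltac frames :=
  repeat match goal with
  | H : frame _ ?f (vars ?s) |- context [vars ?s ?n] => rewrite (H n isT); ev
  | H : frame _ ?f (arr ?s) |- context [arr ?s ?n] => rewrite (H n isT); ev
  end.

Ltac extend_frame :=
  repeat first
    [ exact: frame_refl
    | (apply: frame_upd; [by []|])
    | match goal with H : frame _ ?g ?h |- frame _ ?f ?h =>
        apply: (frame_trans H); [by []|] end ];
  try assumption.

Ltac extension :=
  split; ev; [extend_frame|extend_frame|try by []|try (ev_all; lia)].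

Ltac run := apply: wp_do; ev.

Notation "c1 ;; c2" := (Seq c1 c2) (at level 61, right associativity).

(** * Reading numbers *)

Lemma bits_valK k n : n < 2 ^ k -> bits_val (bits k n) = n.
Proof.
elim: k n => [|k IH] n; first by rewrite expn0; case: n.
rewrite expnS => Hn /=; rewrite IH ?odd_double_half //.
by rewrite ltn_half_double -mul2n.
Qed.

Lemma ltn_width n : n < 2 ^ width n.
Proof. exact: up_logP. Qed.

Lemma size_bits k n : size (bits k n) = k.
Proof. by elim: k n => //= k IH n; rewrite IH. Qed.

Lemma width0 : width 0 = 0.
Proof. exact: up_log1. Qed.

Lemma widthS n : 0 < n -> width n = (width n./2).+1.
Proof. exact: up_log2S. Qed.

Lemma size_encode_nat n : size (encode_nat n) = (width n).*2.+1.
Proof.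
rewrite size_cat addn1 -[in RHS](size_bits (width n) n).
by congr _.+1; elim: (bits _ _) => //= b l ->.
Qed.

Notation v_val := 20 (only parsing).
Notation v_wt := 21 (only parsing).
Notation v_flag := 22 (only parsing).
Notation v_bit := 23 (only parsing).

Definition read_bits : cmd :=
  While v_flag
    (Do [:: BRead v_bit] ;;
     If v_bit (Do [:: BAdd v_val v_val v_wt]) (Do [::]) ;;
     Do [:: BAdd v_wt v_wt v_wt; BRead v_flag]).

Definition read_nat : cmd :=
  Do [:: BSet v_val 0; BSet v_wt 1; BRead v_flag] ;; read_bits.

Definition self_delimited (bs : seq bool) : seq bool :=
  flatten [seq [:: true; b] | b <- bs] ++ [:: false].

(** The flag in front of a digit is consumed before the loop test, which explains [head] in the
    variable and [behead] in the input. A digit costs at most 6 ticks: two tests, two reads, an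
    addition and a doubling. *)
Lemma read_bits_spec bs s rest :
  vars s v_flag = head false (self_delimited bs) ->
  inp s = behead (self_delimited bs ++ rest) ->
  wp read_bits s (fun s' =>
    vars s' v_val = vars s v_val + vars s v_wt * bits_val bs /\
    extends [:: v_val; v_wt; v_flag; v_bit] [::] s s' rest (6 * size bs + 1)).
Proof.
elim: bs s => [|b bs IH] s /= Hf Hi.
  apply: wp_while_done => //; rewrite muln0 addn0; split=> //.
  by extension.
apply: wp_while_step; first by rewrite Hf.
apply: wp_seq; run.
apply: wp_seq; apply: (@wp_mono _ _ (fun s' => 
  vars s' v_val = vars s v_val + b * vars s v_wt /\
    extends [:: v_val; v_bit] [::] s s' (self_delimited bs ++ rest) 4)).
  rewrite Hi /=; apply: wp_if; ev => H; run; split.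
  - by case: b H {Hi} => //=; lia.
  - by extension.
  - by case: b H {Hi} => //=; lia.
  - by extension.
move=> s1 [Hv [Fv Fa Ei Ec]]; run.
apply: wp_mono; first apply: IH; ev.
- by rewrite Ei; case: (bs).
- by rewrite Ei.
ev=> s2 [Hv2 [Fv2 Fa2 Ei2 Ec2]]; split.
  by rewrite Hv2 Hv; frames; case: (b); rewrite -?muln2; lia.
by extension.
Qed.

Lemma read_nat_spec n s rest :
  inp s = encode_nat n ++ rest ->
  wp read_nat s (fun s' => vars s' v_val = n /\
    extends [:: v_val; v_wt; v_flag; v_bit] [::] s s' rest (10 * size (encode_nat n))).
Proof.
move=> Hi; apply: wp_seq; run.
apply: wp_mono; first apply: (read_bits_spec (bs := bits (width n) n) (rest := rest)); ev.
- by rewrite Hi /encode_nat /self_delimited; case: (bits _ _).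
- by rewrite Hi.
ev=> s' [Hv [Fv Fa Ei Ec]]; split.
  by rewrite Hv bits_valK ?ltn_width //; lia.
by rewrite size_bits in Ec; rewrite size_encode_nat; extension.
Qed.

Definition holds (f : nat -> nat) (p : nat) (l : seq nat) : Prop :=
  forall i, i < size l -> f (p + i) = nth 0 l i.

Lemma holds_cat f p l1 l2 :
  holds f p (l1 ++ l2) <-> holds f p l1 /\ holds f (p + size l1) l2.
Proof.
split=> [H|[H1 H2] i].
  split=> i Hi; first by rewrite H ?nth_cat ?Hi // size_cat ltn_addr.
  by rewrite -addnA H ?nth_cat ?size_cat ?ltn_add2l // ltnNge leq_addr /= addKn.
rewrite size_cat nth_cat => Hi'; case: ltnP => Hi; first exact: H1.
by rewrite -H2 -?addnA ?subnKC // ltn_subLR.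
Qed.

Lemma holds_cons f p x l : holds f p (x :: l) <-> f p = x /\ holds f p.+1 l.
Proof.
rewrite -cat1s holds_cat addn1; split=> -[H1 H2]; split=> //.
  by have := H1 0 isT; rewrite addn0.
by case=> // _; rewrite addn0.
Qed.

Lemma holds_eq f g p l :
  (forall i, p <= i < p + size l -> g i = f i) -> holds f p l -> holds g p l.
Proof. by move=> E H i Hi; rewrite E ?H // leq_addr ltn_add2l. Qed.

Lemma holds_rcons_upd f p l x :
  holds f p l -> holds (upd f (p + size l) x) p (rcons l x).
Proof.
move=> H; rewrite -cats1 holds_cat; split.
  by apply: holds_eq H => i Hi; rewrite upd_other //; lia.
by case=> // _; rewrite addn0 upd_same.
Qed.

(** * Parsing the automaton *)

Notation a_code := 1 (only parsing).
Notation a_half := 2 (only parsing).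
Notation a_wire := 3 (only parsing).
Notation a_seen := 4 (only parsing).
Notation a_queue := 5 (only parsing).

Notation v_top := 2 (only parsing).
Notation v_nq := 3 (only parsing).
Notation v_nx := 4 (only parsing).
Notation v_beta := 5 (only parsing).
Notation v_pairs := 6 (only parsing).
Notation v_npairs := 7 (only parsing).
Notation v_trans := 8 (only parsing).
Notation v_ntrans := 9 (only parsing).
Notation v_accept := 10 (only parsing).
Notation v_cnt := 24 (only parsing).
Notation v_cnt2 := 25 (only parsing).

Definition read_store : cmd :=
  read_nat ;; Do [:: BPut a_code v_top v_val; BAddc v_top v_top 1].

Definition read_many : cmd :=
  While v_cnt (read_store ;; Do [:: BSubc v_cnt v_cnt 1]).

(** [code_gate] pads every gate to three numbers, so three times the gate count is the number of
    entries that precede the output count. *)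
Definition read_circuit : cmd :=
  read_store ;;
  Do [:: BAdd v_cnt v_val v_val; BAdd v_cnt v_cnt v_val] ;;
  read_many ;;
  read_store ;;
  Do [:: BAddc v_cnt v_val 0] ;;
  read_many.

Definition read_transitions : cmd :=
  While v_cnt2
    (Do [:: BSet v_cnt 2] ;;
     read_many ;;
     read_circuit ;;
     read_circuit ;;
     Do [:: BSubc v_cnt2 v_cnt2 1]).

Definition stored (s : state) (l : seq nat) : Prop :=
  vars s v_top = size l /\ holds (arr s a_code) 0 l.

Lemma encode_nats_cat l1 l2 : encode_nats (l1 ++ l2) = encode_nats l1 ++ encode_nats l2.
Proof. by rewrite /encode_nats map_cat flatten_cat. Qed.

Lemma encode_nats_cons x l : encode_nats (x :: l) = encode_nat x ++ encode_nats l.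
Proof. by []. Qed.

Lemma encode_nats1 x : encode_nats [:: x] = encode_nat x.
Proof. exact: cats0. Qed.

Lemma size_encode_nat_gt0 n : 0 < size (encode_nat n).
Proof. by rewrite size_encode_nat. Qed.

Lemma size_encode_nats_ge l : size l <= size (encode_nats l).
Proof.
elim: l => //= x l IH.
by rewrite encode_nats_cons size_cat size_encode_nat; lia.
Qed.

Lemma read_store_spec n s rest l :
  inp s = encode_nat n ++ rest -> stored s l ->
  wp read_store s (fun s' => [/\ vars s' v_val = n, stored s' (rcons l n)
    & extends [:: v_val; v_wt; v_flag; v_bit; v_top] [:: a_code] s s' rest
        (12 * size (encode_nat n))]).
Proof.
move=> Hi [Ht Hl]; apply: wp_seq; apply: wp_mono; first exact: read_nat_spec Hi.
move=> s1 [Hv [Fv Fa Ei Ec]]; run; split; rewrite ?Hv //.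
  split; ev; rewrite ?size_rcons; frames; first by rewrite Ht addn1.
  by rewrite Ht; exact: (@holds_rcons_upd _ 0).
by extension; rewrite size_encode_nat in Ec *; lia.
Qed.

Notation parse_vars := [:: v_val; v_wt; v_flag; v_bit; v_top; v_cnt] (only parsing).

Lemma read_many_spec ns s rest l :
  vars s v_cnt = size ns -> inp s = encode_nats ns ++ rest -> stored s l ->
  wp read_many s (fun s' => stored s' (l ++ ns) /\
    extends parse_vars [:: a_code] s s' rest (14 * size (encode_nats ns) + 1)).
Proof.
elim: ns s l => [|n ns IH] s l Hc Hi Hl.
  by apply: wp_while_done => //; rewrite cats0; split=> //; extension.
apply: wp_while_step; first by rewrite Hc.
apply: wp_seq; apply: wp_mono; first apply: (@read_store_spec n _ (encode_nats ns ++ rest) l); ev=> //.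
  by rewrite Hi encode_nats_cons catA.
move=> s1 [Hv Hl1 [Fv Fa Ei Ec]]; run.
apply: wp_mono; first apply: (IH _ (rcons l n)); ev=> //.
  by frames; rewrite Hc /= subn1.
move=> s2 [Hl2 [Fv2 Fa2 Ei2 Ec2]]; split; first by rewrite -cat_rcons.
extension; ev_all; rewrite encode_nats_cons size_cat; rewrite size_encode_nat in Ec *; lia.
Qed.

Lemma size_code_gates gs : size (flatten (map code_gate gs)) = 3 * size gs.
Proof. by elim: gs => // g gs IH; rewrite /= size_cat IH; case: g => * /=; lia. Qed.

Lemma read_circuit_spec n m (C : circuit n m) s rest l :
  inp s = encode_nats (code_circuit C) ++ rest -> stored s l ->
  wp read_circuit s (fun s' => stored s' (l ++ code_circuit C) /\
    extends parse_vars [:: a_code] s s' rest (20 * size (encode_nats (code_circuit C)))).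
Proof.
rewrite /code_circuit; set gs := flatten _; set os := tval (outs C).
have Egs : size gs = 3 * size (gates C) := size_code_gates _.
have Eos : size os = m by rewrite size_tuple.
rewrite encode_nats_cons encode_nats_cat encode_nats_cons => Hi Hl.
have {}Hi : inp s = encode_nat (size (gates C)) ++ encode_nats gs ++
    encode_nat m ++ encode_nats os ++ rest by rewrite Hi -!catA.
apply: wp_seq; apply: wp_mono.
  exact: (read_store_spec Hi Hl).
move=> s1 [Hv1 Hl1 [Fv1 Fa1 Ei1 Ec1]]; apply: wp_seq; run; apply: wp_seq.
apply: wp_mono.
  eapply (@read_many_spec gs); [|exact: Ei1|exact: Hl1].
  by ev; rewrite Hv1 Egs; lia.
move=> s2 [Hl2 [Fv2 Fa2 Ei2 Ec2]]; apply: wp_seq; apply: wp_mono.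
  exact: (read_store_spec Ei2 Hl2).
move=> s3 [Hv3 Hl3 [Fv3 Fa3 Ei3 Ec3]]; apply: wp_seq; run; apply: wp_mono.
  eapply (@read_many_spec os); [|exact: Ei3|exact: Hl3].
  by ev; rewrite Hv3 Eos addn0.
move=> s4 [Hl4 [Fv4 Fa4 Ei4 Ec4]]; split.
  by move: Hl4; rewrite -!cats1 -!catA.
have P1 := size_encode_nat_gt0 (size (gates C)); have P2 := size_encode_nat_gt0 m.
extension; ev_all.
rewrite (size_cat (encode_nat _)) (size_cat (encode_nats _)) (size_cat (encode_nat _)).
lia.
Qed.

Lemma read_transitions_spec nq nx (beta : {ffun 'I_nx -> nat})
    (ds : seq (transition nq beta)) s rest l :
  let code := flatten (map (@code_transition _ _ _) ds) in
  vars s v_cnt2 = size ds -> inp s = encode_nats code ++ rest -> stored s l ->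
  wp read_transitions s (fun s' => stored s' (l ++ code) /\
    extends (v_cnt2 :: parse_vars) [:: a_code] s s' rest
      (30 * size (encode_nats code) + 1)).
Proof.
elim: ds s l => [|d ds IH] s l code Hc Hi Hl.
  by apply: wp_while_done => //; rewrite cats0; split=> //; extension.
apply: wp_while_step; first by rewrite Hc.
set rst := flatten (map (@code_transition _ _ _) ds) in IH.
set c1 := code_circuit (guard d); set c2 := code_circuit (action d).
set h := [:: nat_of_ord (source d); nat_of_ord (target d)].
have Ecode : code = h ++ c1 ++ c2 ++ rst by rewrite /code /= -!catA.
rewrite {}Ecode {code} !encode_nats_cat in Hi *.
have {}Hi : inp s = encode_nats h ++ encode_nats c1 ++ encode_nats c2 ++
  encode_nats rst ++ rest by rewrite Hi -!catA.
have Eh : size (encode_nats h) >= 2 := size_encode_nats_ge h.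
apply: wp_seq; run; apply: wp_seq; apply: wp_mono.
  by eapply (@read_many_spec h); [|exact: Hi|exact: Hl].
move=> s1 [Hl1 [Fv1 Fa1 Ei1 Ec1]]; apply: wp_seq; apply: wp_mono.
  exact: (read_circuit_spec Ei1 Hl1).
move=> s2 [Hl2 [Fv2 Fa2 Ei2 Ec2]]; apply: wp_seq; apply: wp_mono.
  exact: (read_circuit_spec Ei2 Hl2).
move=> s3 [Hl3 [Fv3 Fa3 Ei3 Ec3]]; run; apply: wp_mono.
  eapply IH; [|exact: Ei3|exact: Hl3].
  by ev; frames; rewrite Hc /= subn1.
move=> s4 [Hl4 [Fv4 Fa4 Ei4 Ec4]]; split.
  by move: Hl4; rewrite -!catA.
extension; ev_all; rewrite !(size_cat (encode_nats _)).
rewrite -/c1 in Ec2; rewrite -/c2 in Ec3; lia.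
Qed.

Definition parse : cmd :=
  Do [:: BSet v_cnt 5] ;;
  read_many ;;
  Do [:: BSet v_cnt 0; BGet v_nq a_code v_cnt; BSet v_cnt 2; BGet v_nx a_code v_cnt;
         BSet v_cnt 4; BGet v_accept a_code v_cnt; BAddc v_cnt v_nq 0] ;;
  read_many ;;
  Do [:: BAddc v_beta v_top 0; BAddc v_cnt v_nx 0] ;;
  read_many ;;
  read_store ;;
  Do [:: BAddc v_npairs v_val 0; BAddc v_pairs v_top 0; BAdd v_cnt v_val v_val] ;;
  read_many ;;
  read_store ;;
  Do [:: BAddc v_ntrans v_val 0; BAddc v_trans v_top 0; BAddc v_cnt2 v_val 0] ;;
  read_transitions.

Definition betas (A : automaton) : seq nat :=
  [seq beta A x | x <- enum 'I_(nwatches A)].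

Definition labels (A : automaton) : seq nat :=
  [seq nat_of_ord (label A q) | q <- enum 'I_(nstates A)].

Definition code_pairs (A : automaton) : seq nat :=
  flatten [seq [:: nat_of_ord p.1; nat_of_ord p.2] | p <- enum (active A)].

Definition code_transitions (A : automaton) : seq nat :=
  flatten (map (@code_transition _ _ _) (transitions A)).

(** The code is stored from cell 0 on and its header has five entries: the start state is entry 3
    and the labels begin at 5. The later sections have no fixed position and are found through
    variables. *)
Record parsed (A : automaton) (s : state) : Prop := Parsed {
  parsed_nx : vars s v_nx = nwatches A;
  parsed_accept : vars s v_accept = accept A;
  parsed_npairs : vars s v_npairs = #|active A|;
  parsed_ntrans : vars s v_ntrans = size (transitions A);
  parsed_start : arr s a_code 3 = start A;
  parsed_labels : holds (arr s a_code) 5 (labels A);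
  parsed_beta : holds (arr s a_code) (vars s v_beta) (betas A);
  parsed_pairs : holds (arr s a_code) (vars s v_pairs) (code_pairs A);
  parsed_trans : holds (arr s a_code) (vars s v_trans) (code_transitions A)
}.

Lemma size_betas A : size (betas A) = nwatches A.
Proof. by rewrite size_map size_enum_ord. Qed.

Lemma size_labels A : size (labels A) = nstates A.
Proof. by rewrite size_map size_enum_ord. Qed.

Lemma size_code_pairs A : size (code_pairs A) = 2 * #|active A|.
Proof. by rewrite cardE /code_pairs; elim: (enum _) => //= p l ->; lia. Qed.

Notation parse_writes := [:: v_nq; v_nx; v_accept; v_beta; v_npairs; v_pairs;
  v_ntrans; v_trans; v_cnt2; v_val; v_wt; v_flag; v_bit; v_top; v_cnt] (only parsing).

Lemma parse_spec A s rest :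
  inp s = encode_automaton A ++ rest -> vars s v_top = 0 ->
  wp parse s (fun s' => parsed A s' /\
    extends parse_writes [:: a_code] s s' rest (40 * automaton_size A)).
Proof.
move=> Hi Ht.
set h := [:: nstates A; nletters A; nwatches A; nat_of_ord (start A); nat_of_ord (accept A)].
have Ecode : code_automaton A = h ++ labels A ++ betas A ++ [:: #|active A|] ++
  code_pairs A ++ [:: size (transitions A)] ++ code_transitions A by [].
rewrite /automaton_size /encode_automaton Ecode !encode_nats_cat in Hi *.
have {}Hi : inp s = encode_nats h ++ encode_nats (labels A) ++ encode_nats (betas A)
    ++ encode_nat #|active A| ++ encode_nats (code_pairs A)
    ++ encode_nat (size (transitions A)) ++ encode_nats (code_transitions A) ++ rest.
  by rewrite Hi -!catA.
have Hs : stored s [::] by [].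
have Eh : size (encode_nats h) >= 5 := size_encode_nats_ge h.
apply: wp_seq; run; apply: wp_seq; apply: wp_mono.
  by eapply (@read_many_spec h); [|exact: Hi|exact: Hs].
move=> s1 [Hl1 [Fv1 Fa1 Ei1 Ec1]].
have /= [_ Hh] := Hl1.
apply: wp_seq; run; apply: wp_seq; apply: wp_mono.
  eapply (@read_many_spec (labels A)); [|exact: Ei1|exact: Hl1].
  by ev; rewrite (Hh 0 isT) size_labels addn0.
move=> s2 [Hl2 [Fv2 Fa2 Ei2 Ec2]]; apply: wp_seq; run; apply: wp_seq; apply: wp_mono.
  eapply (@read_many_spec (betas A)); [|exact: Ei2|exact: Hl2].
  by ev; frames; rewrite (Hh 2 isT) size_betas addn0.
move=> s3 [Hl3 [Fv3 Fa3 Ei3 Ec3]]; apply: wp_seq; apply: wp_mono.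
  exact: (read_store_spec Ei3 Hl3).
move=> s4 [Hv4 Hl4 [Fv4 Fa4 Ei4 Ec4]]; apply: wp_seq; run; apply: wp_seq; apply: wp_mono.
  eapply (@read_many_spec (code_pairs A)); [|exact: Ei4|exact: Hl4].
  by ev; rewrite Hv4 size_code_pairs; lia.
move=> s5 [Hl5 [Fv5 Fa5 Ei5 Ec5]]; apply: wp_seq; apply: wp_mono.
  exact: (read_store_spec Ei5 Hl5).
move=> s6 [Hv6 Hl6 [Fv6 Fa6 Ei6 Ec6]]; apply: wp_seq; run; apply: wp_mono.
  eapply (@read_transitions_spec _ _ _ (transitions A)); [|exact: Ei6|exact: Hl6].
  by ev; rewrite Hv6 addn0.
move=> s7 [[Hl7 Hc7] [Fv7 Fa7 Ei7 Ec7]]; split; last first.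
  have P1 := size_encode_nat_gt0 #|active A|.
  have P2 := size_encode_nat_gt0 (size (transitions A)).
  extension; ev_all.
  rewrite !(size_cat (encode_nats _)) !encode_nats1.
  rewrite /code_transitions -/h.
  move: (size (encode_nat #|_|)) (size (encode_nat (size _))) P1 P2 Ec4 Ec6 => x1 x2.
  lia.
move: Hl2 Hl4 Hl6 => [T2 _] [T4 _] [T6 _]; rewrite !size_rcons in T4 T6.
move: Hc7; rewrite -!cats1 !holds_cat -/(code_transitions A).
move=> [[[[[[[_ C0] C1] C2] C3] C4] C5] C6].
split; frames; rewrite ?addn0 ?Hv4 ?Hv6 //.
- by rewrite (Hh 2 isT).
- by rewrite (Hh 4 isT).
- exact: (C0 3).
- by apply: (eq_ind _ (holds _ ^~ _) C2); rewrite T2 !size_cat.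
- by apply: (eq_ind _ (holds _ ^~ _) C4); rewrite T4 !size_cat /= ?addn1 ?add0n.
- by apply: (eq_ind _ (holds _ ^~ _) C6); rewrite T6 !(size_cat, size_rcons) /= ?addn1 ?add0n.
Qed.

Notation v_i := 26 (only parsing).
Notation v_j := 27 (only parsing).
Notation v_k := 28 (only parsing).
Notation v_t := 29 (only parsing).
Notation v_b := 30 (only parsing).
Notation v_v := 31 (only parsing).
Notation v_h := 32 (only parsing).
Notation v_code := 33 (only parsing).
Notation v_wp := 34 (only parsing).
Notation v_o := 35 (only parsing).
Notation v_tp := 36 (only parsing).
Notation v_m := 37 (only parsing).

(** * The table of halves *)

Definition sum_loop : cmd :=
  While v_cnt (Do [:: BGet v_t a_code v_j; BAdd v_m v_m v_t; BAddc v_j v_j 1;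
                      BSubc v_cnt v_cnt 1]).

Definition fill_loop : cmd :=
  While v_m (Do [:: BPut a_half v_i v_h; BAdd v_h v_h v_b; BSet v_t 1;
                    BSub v_b v_t v_b; BAddc v_i v_i 1; BSubc v_m v_m 1]).

Definition half_table : cmd :=
  Do [:: BAddc v_cnt v_nx 0; BAddc v_j v_beta 0; BSet v_m 1] ;;
  sum_loop ;;
  Do [:: BSet v_i 0; BSet v_h 0; BSet v_b 0] ;;
  fill_loop.

Definition halved (s : state) (M : nat) : Prop :=
  forall i, i <= M -> arr s a_half i = i./2.

Lemma sum_loop_spec l s :
  vars s v_cnt = size l -> holds (arr s a_code) (vars s v_j) l ->
  wp sum_loop s (fun s' => vars s' v_m = vars s v_m + sumn l /\
    extends [:: v_cnt; v_j; v_m; v_t] [::] s s' (inp s) (5 * size l + 1)).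
Proof.
elim: l s => [|x l IH] s Hc Hl.
  by apply: wp_while_done => //; rewrite addn0; split=> //; extension.
apply: wp_while_step; first by rewrite Hc.
have [Hx Hl'] := (holds_cons _ _ _ _).1 Hl.
run; apply: wp_mono; first apply: IH; ev.
- by rewrite Hc subn1.
- by rewrite addn1.
move=> s' [Hm [Fv Fa Ei Ec]]; split; last by extension; ev_all; rewrite /=; lia.
by rewrite Hm; ev; rewrite Hx /= addnA.
Qed.

Lemma fill_loop_spec m s :
  vars s v_m = m -> halved s (vars s v_i).-1 \/ vars s v_i = 0 ->
  vars s v_h = (vars s v_i)./2 -> vars s v_b = odd (vars s v_i) ->
  wp fill_loop s (fun s' => (0 < vars s v_i + m -> halved s' (vars s v_i + m).-1) /\
    extends [:: v_m; v_i; v_h; v_b; v_t] [:: a_half] s s' (inp s) (7 * m + 1)).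
Proof.
elim: m s => [|m IH] s Hm Hh Eh Eb.
  apply: wp_while_done => //; rewrite addn0; split; last by extension.
  by case: Hh => [Hh|->].
apply: wp_while_step; first by rewrite Hm.
run; apply: wp_mono; first apply: IH; ev.
- by rewrite Hm subn1.
- left; rewrite addn1 => i /= Hi; ev.
  case: (eqVneq i (vars s v_i)) => [->|/eqP Ne]; first by rewrite upd_same.
  by rewrite upd_other //; case: Hh => [->//|]; lia.
- by rewrite Eh Eb addn1 /= uphalf_half addnC.
- by rewrite Eb addn1 /=; case: odd.
move=> s' [Hh' [Fv Fa Ei Ec]]; split; last by extension.
by move=> _; rewrite -addSnnS -addn1; apply: Hh'; ev; lia.
Qed.

Lemma half_table_spec A s : parsed A s ->
  wp half_table s (fun s' => halved s' (sumn (betas A)) /\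
    extends [:: v_cnt; v_j; v_m; v_t; v_i; v_h; v_b] [:: a_half] s s' (inp s)
      (5 * nwatches A + 7 * sumn (betas A) + 20)).
Proof.
move=> HA; apply: wp_seq; run; apply: wp_seq; apply: wp_mono.
  apply: (@sum_loop_spec (betas A)); ev.
    by rewrite (parsed_nx HA) size_betas addn0.
  by rewrite addn0; exact: parsed_beta HA.
move=> s1 [Hm [Fv Fa Ei Ec]]; apply: wp_seq; run; apply: wp_mono.
  by apply: fill_loop_spec; ev; [exact: Hm|right|..].
move=> s2 [Hh [Fv2 Fa2 Ei2 Ec2]]; split.
  by move: Hh; ev; rewrite add0n add1n /=; apply.
by rewrite size_betas in Ec; extension; ev_all; rewrite Ei2.
Qed.

(** * Loops over the binary digits of the bounds *)

(** The loops below halve a bound until it vanishes, and by [widthS] each halving removes one digit;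
    this is their common induction. *)
Lemma half_ind (P : nat -> Prop) :
  P 0 -> (forall b, 0 < b -> P b./2 -> P b) -> forall b, P b.
Proof.
move=> H0 H b; have [n] := ubnP b; elim: n b => // n IH [//|b] Hb.
by apply: H => //; apply: IH; lia.
Qed.

(** The bound [v_b] is halved along with the value [v_v] and controls the loop, so the block gets
    the width of the bound whatever the value. The digit is [v - h - h] with [h] the half of [v]. *)
Definition emit_bits : cmd :=
  While v_b (Do [:: BGet v_h a_half v_v; BSub v_t v_v v_h; BSub v_t v_t v_h;
                    BPut a_wire v_wp v_t; BAddc v_wp v_wp 1; BAddc v_v v_h 0;
                    BGet v_b a_half v_b]).

Definition emit_wires : cmd :=
  While v_cnt
    (Do [:: BGet v_b a_code v_j; BGet v_v a_queue v_k] ;;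
     emit_bits ;;
     Do [:: BAddc v_j v_j 1; BAddc v_k v_k 1; BSubc v_cnt v_cnt 1]).

Definition wired (s : state) (l : seq bool) : Prop :=
  holds (arr s a_wire) 0 (map nat_of_bool l).

Lemma emit_bits_spec b M s l :
  halved s M -> vars s v_b = b -> b <= M -> vars s v_v <= M ->
  vars s v_wp = size l -> wired s l ->
  wp emit_bits s (fun s' =>
    [/\ wired s' (l ++ bits (width b) (vars s v_v)),
        vars s' v_wp = size l + width b
      & extends [:: v_b; v_v; v_h; v_t; v_wp] [:: a_wire] s s' (inp s)
         (8 * width b + 1)]).
Proof.
elim/half_ind: b s l => [|b b_gt0 IH] s l Hh Eb bM vM Ew Hw.
  by apply: wp_while_done => //; rewrite width0 cats0 addn0; split=> //; extension.
apply: wp_while_step; first by rewrite Eb; lia.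
rewrite (widthS b_gt0) -cat_rcons; run; apply: wp_mono.
  apply: (IH _ (rcons l (odd (vars s v_v)))); ev => //.
  - by rewrite Eb Hh.
  - by lia.
  - by rewrite Hh; lia.
  - by rewrite Ew size_rcons addn1.
  rewrite Ew Hh //.
  have -> : vars s v_v - (vars s v_v)./2 - (vars s v_v)./2 = odd (vars s v_v) by lia.
  by rewrite /wired map_rcons; rewrite -(size_map nat_of_bool); exact: (@holds_rcons_upd _ 0).
ev=> s' [Hw' Ew' [Fv Fa Ei Ec]]; split.
- by move: Hw'; rewrite Hh // addn0.
- by rewrite Ew' size_rcons addSnnS.
- by extension.
Qed.

Definition pair_bits (p : nat * nat) : seq bool := bits (width p.1) p.2.

Lemma emit_wires_spec bs vs M s l :
  size bs = size vs -> halved s M -> all (leq^~ M) bs -> all (leq^~ M) vs ->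
  vars s v_cnt = size bs ->
  holds (arr s a_code) (vars s v_j) bs -> holds (arr s a_queue) (vars s v_k) vs ->
  vars s v_wp = size l -> wired s l ->
  wp emit_wires s (fun s' =>
    [/\ wired s' (l ++ flatten (map pair_bits (zip bs vs))),
        vars s' v_wp = size l + sumn (map width bs)
      & extends [:: v_cnt; v_j; v_k; v_b; v_v; v_h; v_t; v_wp] [:: a_wire] s s' (inp s)
         (8 * sumn (map width bs) + 7 * size bs + 1)]).
Proof.
elim: bs vs s l => [|b bs IH] [|v vs] s l //.
  by move=> *; apply: wp_while_done => //; rewrite cats0 addn0; split=> //; extension.
case=> Es Hh /= /andP[bM bsM] /andP[vM vsM] Ec Hb Hv Ew Hw.
have [Eb Hb'] := (holds_cons _ _ _ _).1 Hb; have [Ev Hv'] := (holds_cons _ _ _ _).1 Hv.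
apply: wp_while_step; first by rewrite Ec.
apply: wp_seq; run; apply: wp_seq; apply: wp_mono.
  by apply: (@emit_bits_spec b M _ l); ev; rewrite ?Ev.
move=> s1 [Hw1 Ew1 [Fv1 Fa1 Ei1 Ec1]]; run; apply: wp_mono.
  apply: (IH vs _ (l ++ bits (width b) v)); ev => //.
  - by move=> i Hi; ev; frames; exact: Hh.
  - by frames; rewrite Ec subn1.
  - by frames; rewrite addn1.
  - by frames; rewrite addn1.
  - by rewrite Ew1 size_cat size_bits.
  - by move: Hw1; ev; rewrite Ev.
move=> s2 [Hw2 Ew2 [Fv2 Fa2 Ei2 Ec2]]; split.
- by move: Hw2; rewrite -catA.
- by rewrite Ew2 size_cat size_bits addnA.
- by extension; ev_all; rewrite Ei2.
Qed.

Definition shift_code : cmd :=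
  While v_b (Do [:: BAdd v_code v_code v_code; BGet v_b a_half v_b]).

Definition build_code : cmd :=
  While v_cnt
    (Do [:: BGet v_b a_code v_j; BGet v_v a_queue v_k] ;;
     shift_code ;;
     Do [:: BAdd v_code v_code v_v; BAddc v_j v_j 1; BAddc v_k v_k 1;
            BSubc v_cnt v_cnt 1]).

Lemma shift_code_spec b M s :
  halved s M -> vars s v_b = b -> b <= M ->
  wp shift_code s (fun s' => vars s' v_code = vars s v_code * 2 ^ width b /\
    extends [:: v_b; v_code] [::] s s' (inp s) (3 * width b + 1)).
Proof.
elim/half_ind: b s => [|b b_gt0 IH] s Hh Eb bM.
  by apply: wp_while_done => //; rewrite width0 muln1; split=> //; extension.
apply: wp_while_step; first by rewrite Eb; lia.
rewrite (widthS b_gt0); run; apply: wp_mono.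
  apply: IH; ev => //; [by rewrite Eb Hh|by lia].
ev=> s' [Ec [Fv Fa Ei Et]]; split; last by extension.
by rewrite Ec expnS; lia.
Qed.

Definition code_step (c : nat) (p : nat * nat) : nat := c * 2 ^ width p.1 + p.2.

(** The final [v_k] points just past the record; [commit] takes it as the new tail of the queue. *)
Lemma build_code_spec bs vs M s :
  size bs = size vs -> halved s M -> all (leq^~ M) bs ->
  vars s v_cnt = size bs ->
  holds (arr s a_code) (vars s v_j) bs -> holds (arr s a_queue) (vars s v_k) vs ->
  wp build_code s (fun s' =>
    [/\ vars s' v_code = foldl code_step (vars s v_code) (zip bs vs),
        vars s' v_k = vars s v_k + size bs
      & extends [:: v_cnt; v_j; v_k; v_b; v_v; v_code] [::] s s' (inp s)
         (3 * sumn (map width bs) + 8 * size bs + 1)]).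
Proof.
elim: bs vs s => [|b bs IH] [|v vs] s //.
  by move=> *; apply: wp_while_done => //; rewrite addn0; split=> //; extension.
case=> Es Hh /= /andP[bM bsM] Ec Hb Hv.
have [Eb Hb'] := (holds_cons _ _ _ _).1 Hb; have [Ev Hv'] := (holds_cons _ _ _ _).1 Hv.
apply: wp_while_step; first by rewrite Ec.
apply: wp_seq; run; apply: wp_seq; apply: wp_mono.
  by apply: (@shift_code_spec b M); ev.
move=> s1 [Ec1 [Fv1 Fa1 Ei1 Et1]]; run; apply: wp_mono.
  apply: (IH vs); ev => //.
  - by move=> i Hi; ev; frames; exact: Hh.
  - by frames; rewrite Ec subn1.
  - by frames; rewrite addn1.
  - by frames; rewrite addn1.
move=> s2 [Ec2 Ek2 [Fv2 Fa2 Ei2 Et2]]; split.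
- by rewrite Ec2; ev; frames; rewrite Ec1; ev; rewrite Ev.
- by rewrite Ek2; ev; frames; rewrite addn1 addSnnS.
- by extension; ev_all; rewrite Ei2.
Qed.

Notation v_n := 38 (only parsing).
Notation v_g := 39 (only parsing).
Notation v_op := 40 (only parsing).
Notation v_x := 41 (only parsing).
Notation v_y := 42 (only parsing).
Notation v_wq := 43 (only parsing).

Definition decode_bits : cmd :=
  While v_b
    (Do [:: BGet v_o a_code v_tp; BGet v_t a_wire v_o] ;;
     If v_t (Do [:: BAdd v_val v_val v_wt]) (Do [::]) ;;
     Do [:: BAddc v_tp v_tp 1; BAdd v_wt v_wt v_wt; BGet v_b a_half v_b]).

(** With truncated subtraction, [val - (val - m)] is the minimum of [val] and [m]: this clips the
    decoded number to the bound. *)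
Definition decode_values : cmd :=
  While v_cnt
    (Do [:: BGet v_m a_code v_j; BAddc v_b v_m 0; BSet v_val 0; BSet v_wt 1] ;;
     decode_bits ;;
     Do [:: BSub v_t v_val v_m; BSub v_val v_val v_t; BPut a_queue v_k v_val;
            BAddc v_j v_j 1; BAddc v_k v_k 1; BSubc v_cnt v_cnt 1]).

Definition carries (s : state) (os : seq nat) (bs : seq bool) : Prop :=
  map (arr s a_wire) os = map nat_of_bool bs.

Lemma decode_bits_spec b M s os bs :
  halved s M -> vars s v_b = b -> b <= M -> size os = width b ->
  holds (arr s a_code) (vars s v_tp) os -> carries s os bs ->
  wp decode_bits s (fun s' =>
    [/\ vars s' v_val = vars s v_val + vars s v_wt * bits_val bs,
        vars s' v_tp = vars s v_tp + width b
      & extends [:: v_b; v_o; v_tp; v_t; v_val; v_wt] [::] s s' (inp s)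
         (8 * width b + 1)]).
Proof.
elim/half_ind: b s os bs => [|b b_gt0 IH] s os bs Hh Eb bM Es Ho Hc.
  move: Es Hc; rewrite width0; case: os Ho => // _ _; case: bs => // _.
  by apply: wp_while_done => //; rewrite /= muln0 !addn0; split=> //; extension.
move: Es; rewrite (widthS b_gt0).
case: os bs Ho Hc => // o os [//|u bs] /holds_cons [Eo Ho] [Hu Hc] [Es].
apply: wp_while_step; first by rewrite Eb; lia.
apply: wp_seq; run; apply: wp_seq.
apply: (@wp_mono _ _ (fun s' => vars s' v_val = vars s v_val + u * vars s v_wt /\
    extends [:: v_o; v_t; v_val] [::] s s' (inp s) 5)).
  apply: wp_if; ev; rewrite Eo Hu => H; run; split; try by extension.
    by case: (u) H => //; lia.
  by case: (u) H => //; lia.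
move=> s1 [Ev1 [Fv1 Fa1 Ei1 Ec1]]; run; apply: wp_mono.
  apply: (IH _ os bs); ev => //.
  - by move=> i Hi; ev; frames; exact: Hh.
  - by frames; rewrite Eb Hh.
  - by lia.
  - by frames; rewrite addn1.
  - by rewrite /carries; ev; frames.
move=> s2 [Ev2 Et2 [Fv2 Fa2 Ei2 Ec2]]; split.
- by rewrite Ev2; ev; frames; rewrite Ev1 /=; case: (u); lia.
- by rewrite Et2; ev; frames; lia.
- by extension; ev_all; rewrite Ei2.
Qed.

Definition clipped_values (bs : seq nat) (us : seq bool) : seq nat :=
  [seq minn (bits_val p.2) p.1 | p <- zip bs (reshape (map width bs) us)].

Lemma decode_values_spec bs M s os us :
  halved s M -> all (leq^~ M) bs -> vars s v_cnt = size bs ->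
  holds (arr s a_code) (vars s v_j) bs ->
  size os = sumn (map width bs) -> holds (arr s a_code) (vars s v_tp) os ->
  carries s os us ->
  wp decode_values s (fun s' =>
    [/\ holds (arr s' a_queue) (vars s v_k) (clipped_values bs us),
        forall i, i < vars s v_k -> arr s' a_queue i = arr s a_queue i,
        vars s' v_tp = vars s v_tp + size os
      & extends [:: v_cnt; v_j; v_k; v_m; v_b; v_o; v_tp; v_t; v_val; v_wt] [:: a_queue]
         s s' (inp s) (8 * size os + 14 * size bs + 1)]).
Proof.
elim: bs s os us => [|b bs IH] s os us Hh.
  move=> _ Ec Hb Es Ho Hc; case: os {Ho Hc} Es => // _.
  by apply: wp_while_done => //; rewrite addn0; split=> //; extension.
move=> /= /andP[bM bsM] Ec /holds_cons [Eb Hb] Es Ho Hc.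
pose os1 := take (width b) os; pose os2 := drop (width b) os.
pose us1 := take (width b) us; pose us2 := drop (width b) us.
have Es1 : size os1 = width b by rewrite size_takel // Es leq_addr.
have Es2 : size os2 = sumn (map width bs) by rewrite size_drop Es addKn.
have [Ho1 Ho2] : holds (arr s a_code) (vars s v_tp) os1 /\
    holds (arr s a_code) (vars s v_tp + size os1) os2.
  by apply/holds_cat; rewrite cat_take_drop.
have Hc1 : carries s os1 us1 by rewrite /carries !map_take Hc.
have Hc2 : carries s os2 us2 by rewrite /carries !map_drop Hc.
apply: wp_while_step; first by rewrite Ec.
apply: wp_seq; run; apply: wp_seq; apply: wp_mono.
  by apply: (@decode_bits_spec b M _ os1 us1); ev => //; rewrite Eb addn0.
move=> s1 [Ev1 Et1 [Fv1 Fa1 Ei1 Ec1]]; run; apply: wp_mono.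
  apply: (IH _ os2 us2); ev => //.
  - by move=> i Hi; ev; frames; exact: Hh.
  - by frames; rewrite Ec subn1.
  - by frames; rewrite addn1.
  - by frames; rewrite Et1 -Es1.
  - by rewrite /carries; ev; frames.
move=> s2; ev; frames; rewrite !Ev1 !Et1; ev; rewrite Eb add0n mul1n.
move=> [Hq2 Lq2 Et2 [Fv2 Fa2 Ei2 Ec2]]; split.
- have -> : clipped_values (b :: bs) us = minn (bits_val us1) b :: clipped_values bs us2.
    by [].
  apply/holds_cons; split.
    by rewrite Lq2 ?addn1 // upd_same; lia.
  by move: Hq2; rewrite addn1.
- by move=> i Hi; rewrite Lq2 ?upd_other //; lia.
- by rewrite Et2 Es2 Es -addnA.
- by rewrite Es2 in Ec2; rewrite Es; extension; ev_all; rewrite ?Ei2 ?Ei1.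
Qed.

(** * Circuit evaluation *)

(** Arithmetic on 0 and 1 with truncated subtraction: negation is [1 - i], conjunction [i + j - 1],
    disjunction [1 - (1 - (i + j))]. A constant carries its value in the first operand. *)
Definition gate_value : cmd :=
  If v_op
    (Do [:: BSubc v_op v_op 1] ;;
     If v_op
       (Do [:: BSubc v_op v_op 1] ;;
        If v_op
          (Do [:: BAdd v_i v_i v_j; BSet v_t 1; BSub v_i v_t v_i; BSub v_t v_t v_i])
          (Do [:: BAdd v_t v_i v_j; BSubc v_t v_t 1]))
       (Do [:: BSet v_t 1; BSub v_t v_t v_i]))
    (Do [:: BAddc v_t v_x 0]).

Definition gate_loop : cmd :=
  While v_g
    (Do [:: BGet v_op a_code v_tp; BAddc v_tp v_tp 1;
            BGet v_x a_code v_tp; BAddc v_tp v_tp 1;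
            BGet v_y a_code v_tp; BAddc v_tp v_tp 1;
            BGet v_i a_wire v_x; BGet v_j a_wire v_y] ;;
     gate_value ;;
     Do [:: BPut a_wire v_wq v_t; BAddc v_wq v_wq 1; BSubc v_g v_g 1]).

Definition run_circuit : cmd :=
  Do [:: BGet v_g a_code v_tp; BAddc v_tp v_tp 1; BAddc v_wq v_n 0] ;;
  gate_loop ;;
  Do [:: BAddc v_tp v_tp 1].

Lemma wired_nth s l i : wired s l -> i < size l -> arr s a_wire i = nth false l i.
Proof.
by move=> H Hi; have := H i; rewrite size_map add0n => -> //; rewrite (nth_map false).
Qed.

Lemma gate_value_spec g l s :
  gate_ok (size l) g -> wired s l ->
  code_gate g = [:: vars s v_op; vars s v_x; vars s v_y] ->
  vars s v_i = arr s a_wire (vars s v_x) -> vars s v_j = arr s a_wire (vars s v_y) ->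
  wp gate_value s (fun s' => vars s' v_t = eval_gate l g /\
    extends [:: v_op; v_i; v_t] [::] s s' (inp s) 10).
Proof.
move=> Hg Hw E Ei Ej; rewrite /gate_value.
case: g Hg E => [b|i|i j|i j] /= Hg [Eop Ex Ey].
- apply: wp_if; rewrite -Eop // => _; run; split; last by extension.
  by rewrite -Ex addn0.
- apply: wp_if; rewrite -Eop // => _; apply: wp_seq; run.
  apply: wp_if; ev; rewrite -Eop subn1 // => _; run; split; last by extension.
  by rewrite Ei -Ex (wired_nth Hw) //; case: nth.
- have /andP[Hi Hj] := Hg.
  apply: wp_if; rewrite -Eop // => _; apply: wp_seq; run.
  apply: wp_if; ev; rewrite -Eop subn1 // => _; apply: wp_seq; run.
  apply: wp_if; ev; rewrite subn1 // => _; run; split; last by extension.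
  by rewrite Ei Ej -Ex -Ey !(wired_nth Hw) //; do 2 case: nth.
- have /andP[Hi Hj] := Hg.
  apply: wp_if; rewrite -Eop // => _; apply: wp_seq; run.
  apply: wp_if; ev; rewrite -Eop subn1 // => _; apply: wp_seq; run.
  apply: wp_if; ev; rewrite subn1 // => _; run; split; last by extension.
  by rewrite Ei Ej -Ex -Ey !(wired_nth Hw) //; do 2 case: nth.
Qed.

Lemma gate_loop_spec gs l s :
  gates_ok (size l) gs -> vars s v_g = size gs ->
  holds (arr s a_code) (vars s v_tp) (flatten (map code_gate gs)) ->
  vars s v_wq = size l -> wired s l ->
  wp gate_loop s (fun s' =>
    [/\ wired s' (eval_gates l gs), vars s' v_tp = vars s v_tp + 3 * size gs
      & extends [:: v_g; v_op; v_x; v_y; v_i; v_j; v_t; v_wq; v_tp] [:: a_wire] s s'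
          (inp s) (25 * size gs + 1)]).
Proof.
elim: gs l s => [|g gs IH] l s.
  by move=> _ Eg _ _ Hw; apply: wp_while_done => //; rewrite addn0; split=> //; extension.
move=> /= /andP[Hg Hgs] Eg /holds_cat[Hc Hcs] Ew Hw.
have Hsz : size (code_gate g) = 3 by case: (g).
rewrite Hsz in Hcs.
have Ec : code_gate g = [:: arr s a_code (vars s v_tp); arr s a_code (vars s v_tp + 1);
    arr s a_code (vars s v_tp + 2)].
  have := Hc 0; have := Hc 1; have := Hc 2; rewrite Hsz => -> // -> //; rewrite addn0 => -> //.
  by case: (code_gate g) Hsz => // x [|y [|z []]].
apply: wp_while_step; first by rewrite Eg.
apply: wp_seq; run; apply: wp_seq; apply: wp_mono.
  by apply: (@gate_value_spec g l); ev => //; rewrite Ec -addnA.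
move=> s1 [Et [Fv1 Fa1 Ei1 Ec1]]; run; apply: wp_mono.
  apply: (IH (rcons l (eval_gate l g))); ev.
  - by rewrite size_rcons.
  - by frames; rewrite Eg subn1.
  - by frames; rewrite -!addnA.
  - by frames; rewrite Ew size_rcons addn1.
  - rewrite /wired; ev; frames; rewrite Ew Et map_rcons -(size_map nat_of_bool).
    exact: (@holds_rcons_upd _ 0).
move=> s2 [Hw2 Et2 [Fv2 Fa2 Ei2 Ec2]]; split=> //.
- by rewrite Et2; ev; frames; lia.
- by extension; ev_all; rewrite Ei2.
Qed.

(** Gates only append wires, so the inputs survive a run. One copy of the encoded assignment thus
    serves the guards and actions of all transitions. *)
Lemma eval_gates_prefix v gs : exists2 u, eval_gates v gs = v ++ u & size u = size gs.
Proof.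
elim: gs v => [|g gs IH] v /=; first by exists [::]; rewrite ?cats0.
have [u -> Eu] := IH (rcons v (eval_gate v g)).
by exists (eval_gate v g :: u); rewrite ?cat_rcons //= Eu.
Qed.

(** The code pointer stops at the list of outputs, because the caller consumes it: a single wire for
    a guard, one block per stopwatch for an action. *)
Lemma run_circuit_spec n m (C : circuit n m) v s :
  size v = n ->
  holds (arr s a_code) (vars s v_tp) (code_circuit C) ->
  vars s v_n = size v -> wired s v ->
  wp run_circuit s (fun s' =>
    [/\ wired s' v, carries s' (outs C) (eval_circuit C v),
        vars s' v_tp + m = vars s v_tp + size (code_circuit C),
        holds (arr s a_code) (vars s' v_tp) (outs C)
      & extends [:: v_g; v_op; v_x; v_y; v_i; v_j; v_t; v_wq; v_tp] [:: a_wire] s s'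
          (inp s) (25 * size (code_circuit C))]).
Proof.
move=> Ev; subst n.
move=> /[dup] /holds_cons[Eg /holds_cat[Hg]]; rewrite size_code_gates => /holds_cons[_ Ho].
move=> _ En Hw.
have Esz : size (code_circuit C) = 3 * size (gates C) + m + 2.
  by rewrite /= size_cat size_code_gates /= size_tuple; lia.
apply: wp_seq; run; apply: wp_seq; apply: wp_mono.
  apply: (@gate_loop_spec (gates C) v); ev => //; rewrite ?addn1 ?addn0 ?En //.
  exact: gates_wf.
move=> s1 [Hw1 Et [Fv1 Fa1 Ei1 Ec1]]; run.
have [u Eu Su] := eval_gates_prefix v (gates C).
split.
- move: Hw1; rewrite Eu /wired map_cat holds_cat; ev; tauto.
- rewrite /carries /eval_circuit -map_comp; ev; apply/eq_in_map => o Oo /=.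
  rewrite (wired_nth Hw1) // Eu size_cat Su.
  by have /allP := outs_wf C; apply.
- by rewrite Et; ev; rewrite Esz; lia.
- by rewrite Et; ev; rewrite !addn1; exact: Ho.
- by extension; ev_all; rewrite Esz; lia.
Qed.

(** * Nodes as records of numbers *)

Definition values (A : automaton) (xi : assignment A) : seq nat :=
  [seq nat_of_ord (xi x) | x <- enum 'I_(nwatches A)].

Definition node_record (A : automaton) (v : node A) : seq nat :=
  nat_of_ord v.1 :: values v.2.

Definition node_key (A : automaton) (v : node A) : nat :=
  foldl code_step v.1 (zip (betas A) (values v.2)).

Definition nbits (A : automaton) : nat := sumn (map width (betas A)).

Lemma size_values A (xi : assignment A) : size (values xi) = nwatches A.
Proof. by rewrite size_map size_enum_ord. Qed.

Lemma size_node_record A (v : node A) : size (node_record v) = (nwatches A).+1.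
Proof. by rewrite /= size_values. Qed.

Lemma nth_betas A (x : 'I_(nwatches A)) : nth 0 (betas A) x = beta A x.
Proof. by rewrite (nth_map x) ?size_enum_ord // nth_ord_enum. Qed.

Lemma nth_values A (xi : assignment A) (x : 'I_(nwatches A)) : nth 0 (values xi) x = xi x.
Proof. by rewrite (nth_map x) ?size_enum_ord // nth_ord_enum. Qed.

Lemma values_inj A : injective (@values A).
Proof.
move=> xi xi' E; apply/ffunP => x; apply: val_inj => /=.
by rewrite -!nth_values E.
Qed.

Lemma values_le A (xi : assignment A) : all2 leq (values xi) (betas A).
Proof.
rewrite /values /betas; elim: (enum _) => //= x l ->; rewrite andbT -ltnS.
exact: ltn_ord.
Qed.

(** A step appends a block of [width b] digits to the code, and a value at most [b] fits into it;
    quotient and remainder modulo [2 ^ width b] recover both parts. *)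
Lemma code_step_inj bs vs vs' c c' :
  all2 leq vs bs -> all2 leq vs' bs ->
  foldl code_step c (zip bs vs) = foldl code_step c' (zip bs vs') -> c = c' /\ vs = vs'.
Proof.
elim: bs vs vs' c c' => [|b bs IH] [|v vs] [|v' vs'] c c' //= /andP[Hv Hvs] /andP[Hv' Hvs'].
case/(IH _ _ _ _ Hvs Hvs'); rewrite /code_step /= => E ->.
have L := ltn_width b; have P : 0 < 2 ^ width b by rewrite expn_gt0.
have Ev : v = v'.
  have := congr1 (modn^~ (2 ^ width b)) E.
  by rewrite !modnMDl !modn_small //; [exact: leq_ltn_trans L|exact: leq_ltn_trans L].
split; last by rewrite Ev.
by move/eqP: E; rewrite Ev eqn_add2r eqn_pmul2r // => /eqP.
Qed.

Lemma node_key_inj A : injective (@node_key A).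
Proof.
move=> [q xi] [q' xi'] /(code_step_inj (values_le _) (values_le _)) [/= E /values_inj ->].
by rewrite (val_inj E).
Qed.

Lemma zip_map_diag (T : Type) (f g : T -> nat) l :
  zip (map f l) (map g l) = [seq (f x, g x) | x <- l].
Proof. by elim: l => //= x l ->. Qed.

Lemma encode_assignmentE A (xi : assignment A) :
  encode_assignment xi = flatten (map pair_bits (zip (betas A) (values xi))).
Proof. by rewrite /betas /values zip_map_diag -map_comp. Qed.

Lemma block_widthsE A : block_widths (beta A) = map width (betas A).
Proof. by rewrite -map_comp. Qed.

Lemma size_encode_assignment A (xi : assignment A) :
  size (encode_assignment xi) = sumn (block_widths (beta A)).
Proof.
rewrite /encode_assignment size_flatten /shape -map_comp; congr sumn.
by apply: eq_map => x /=; rewrite size_bits.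
Qed.

Lemma values_clip A (f : 'I_(nwatches A) -> nat) :
  values (clip f) = [seq minn (f x) (beta A x) | x <- enum 'I_(nwatches A)].
Proof.
apply: eq_map => x /=; rewrite ffunE inordK // ltnS geq_minr //.
Qed.

Lemma values_act A (a : circuit (sumn (block_widths (beta A))) (sumn (block_widths (beta A))))
    (xi : assignment A) :
  values (act a xi) = clipped_values (betas A) (eval_circuit a (encode_assignment xi)).
Proof.
rewrite /act values_clip /clipped_values -block_widthsE.
set bl := reshape _ _.
have Sb : size bl = nwatches A by rewrite size_reshape size_map size_enum_ord.
apply: (@eq_from_nth _ 0).
  by rewrite size_map size_enum_ord size_map size_zip size_betas Sb minnn.
move=> i; rewrite size_map size_enum_ord => Hi; pose x := Ordinal Hi.
rewrite (nth_map x) ?size_enum_ord // (nth_map (0, [::])).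
  by rewrite nth_zip ?size_betas ?Sb //= (nth_ord_enum x x) -(nth_betas x).
by rewrite size_zip size_betas Sb minnn.
Qed.

Lemma leq_sumn l x : x \in l -> x <= sumn l.
Proof.
elim: l => //= y l IH; rewrite inE => /orP[/eqP->|/IH H]; first exact: leq_addr.
exact: leq_trans H (leq_addl _ _).
Qed.

Lemma betas_le_sum A : all (leq^~ (sumn (betas A))) (betas A).
Proof. by apply/allP => x /leq_sumn. Qed.

Lemma values_le_sum A (xi : assignment A) : all (leq^~ (sumn (betas A))) (values xi).
Proof.
apply/allP => _ /mapP[x _ ->]; apply: (@leq_trans (beta A x)).
  by rewrite -ltnS ltn_ord.
by apply: leq_sumn; apply: map_f; rewrite mem_enum.
Qed.

(** * Committing a tentative record *)

Notation v_stamp := 11 (only parsing).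
Notation v_hit := 12 (only parsing).
Notation v_head := 13 (only parsing).
Notation v_tail := 14 (only parsing).
Notation v_lim := 15 (only parsing).
Notation v_letter := 16 (only parsing).
Notation v_left := 17 (only parsing).
Notation v_base := 18 (only parsing).
Notation v_q := 44 (only parsing).
Notation v_d := 45 (only parsing).
Notation v_e := 46 (only parsing).
Notation v_src := 47 (only parsing).
Notation v_tgt := 48 (only parsing).
Notation v_gv := 49 (only parsing).
Notation v_p := 50 (only parsing).
Notation v_a := 51 (only parsing).
Notation v_w := 52 (only parsing).

Notation work_vars := [:: v_val; v_wt; v_flag; v_bit; v_cnt; v_cnt2; v_i; v_j; v_k; v_t;
  v_b; v_v; v_h; v_code; v_wp; v_o; v_tp; v_m; v_n; v_g; v_op; v_x; v_y; v_wq; v_q;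
  v_d; v_e; v_src; v_tgt; v_gv; v_p; v_a; v_w; v_stamp; v_hit; v_head; v_tail; v_lim;
  v_letter; v_left; v_base] (only parsing).

Notation work_arrays := [:: a_wire; a_seen; a_queue] (only parsing).

Record ready (A : automaton) (s : state) : Prop := Ready {
  ready_parsed :> parsed A s;
  ready_halved : halved s (sumn (betas A))
}.

(** Nothing that [parsed] or [halved] mentions occurs in [work_vars] or [work_arrays], so readiness
    persists through all later loops. *)
Lemma ready_frame A s s' :
  ready A s -> frame work_vars (vars s) (vars s') ->
  frame work_arrays (arr s) (arr s') -> ready A s'.
Proof.
move=> [[? ? ? ? ? ? ? ? ?] Hh] Fv Fa; split; last by rewrite /halved; frames.
by split; frames.
Qed.

(* The record of a new node is first written at the tail of the queue; committing
   advances the tail only if the node was not seen in the current layer. *)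
Definition commit : cmd :=
  Do [:: BGet v_q a_queue v_tail; BSub v_d v_q v_accept; BSub v_e v_accept v_q;
         BAdd v_d v_d v_e] ;;
  If v_d
    (Do [:: BAddc v_code v_q 0; BAddc v_j v_beta 0; BAddc v_k v_tail 1;
            BAddc v_cnt v_nx 0] ;;
     build_code ;;
     Do [:: BGet v_t a_seen v_code; BSub v_t v_stamp v_t] ;;
     If v_t (Do [:: BPut a_seen v_code v_stamp; BAddc v_tail v_k 0]) (Do [::]))
    (Do [:: BAddc v_hit v_stamp 0]).

Definition push (A : automaton) (st : seq (node A) * bool) (v : node A) :
    seq (node A) * bool :=
  if v.1 == accept A then (st.1, true)
  else (if v \in st.1 then st.1 else rcons st.1 v, st.2).

(** All stamps are at most [K], so the truncated difference of [K] and a stamp is 0 exactly for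
    marks of the current layer, and increasing [K] empties the set of visited nodes at once. The
    flag for acceptance is a stamp for the same reason. *)
Record layer (A : automaton) (s : state) (base K : nat) (st : seq (node A) * bool) :
    Prop := Layer {
  layer_queue : holds (arr s a_queue) base (flatten (map (@node_record A) st.1));
  layer_tail : vars s v_tail = base + size st.1 * (nwatches A).+1;
  layer_stamp : vars s v_stamp = K;
  layer_seen_le : forall u : node A, arr s a_seen (node_key u) <= K;
  layer_seen : forall u : node A, (arr s a_seen (node_key u) == K) = (u \in st.1);
  layer_hit_le : vars s v_hit <= K;
  layer_hit : (vars s v_hit == K) = st.2
}.

Lemma size_records A (ns : seq (node A)) :
  size (flatten (map (@node_record A) ns)) = size ns * (nwatches A).+1.
Proof. by elim: ns => //= v ns IH; rewrite size_cat IH size_values mulSn. Qed.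

Notation commit_vars := [:: v_q; v_d; v_e; v_code; v_j; v_k; v_cnt; v_b; v_v; v_t;
  v_tail; v_hit] (only parsing).

Lemma commit_spec A s base K st (v : node A) :
  ready A s -> layer s base K st -> holds (arr s a_queue) (vars s v_tail) (node_record v) ->
  wp commit s (fun s' => layer s' base K (push st v) /\
    extends commit_vars [:: a_seen] s s' (inp s) (3 * nbits A + 8 * nwatches A + 20)).
Proof.
move=> HA HL /[dup] HR /holds_cons[Eq Hv]; apply: wp_seq; run; rewrite /push.
apply: wp_if; ev; rewrite Eq (parsed_accept HA) => Hd.
  have -> : (v.1 == accept A) = false by apply/eqP => E; rewrite E subnn in Hd.
  apply: wp_seq; run; apply: wp_seq; apply: wp_mono.
    apply: (@build_code_spec (betas A) (values v.2) (sumn (betas A))); ev.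
    - by rewrite size_betas size_values.
    - exact: ready_halved HA.
    - exact: betas_le_sum.
    - by rewrite (parsed_nx HA) size_betas addn0.
    - by rewrite addn0; exact: (parsed_beta HA).
    - by rewrite addn1.
  ev; rewrite addn0 => s1 [Ec1 Ek1 [Fv1 Fa1 Ei1 Et1]].
  rewrite -/(node_key v) in Ec1.
  rewrite size_betas in Ek1 Et1; rewrite -/(nbits A) in Et1.
  apply: wp_seq; run.
  have Hseen := layer_seen HL v; have Hle := layer_seen_le HL v.
  have HK := layer_stamp HL.
  apply: wp_if; ev; frames; rewrite Ec1 HK => Ht; run; split; try by extension; ev_all; rewrite Ei1.
    have -> : (v \in st.1) = false by rewrite -Hseen; apply/eqP; lia.
    split; ev; frames; rewrite ?HK ?Ec1 //=.
    + rewrite map_rcons flatten_rcons holds_cat; split; first exact: layer_queue HL.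
      by rewrite size_records -(layer_tail HL).
    + by rewrite Ek1 size_rcons (layer_tail HL); lia.
    + move=> u; case: (eqVneq (node_key u) (node_key v)) => [->|/eqP Ne].
        by rewrite upd_same.
      by rewrite upd_other //; exact: layer_seen_le HL u.
    + move=> u; rewrite mem_rcons inE -(layer_seen HL u).
      case: (eqVneq u v) => [->|Ne]; first by rewrite upd_same eqxx.
      by rewrite upd_other // => /node_key_inj E; rewrite E eqxx in Ne.
    + exact: layer_hit_le HL.
    + exact: layer_hit HL.
  have -> : v \in st.1 by rewrite -Hseen; apply/eqP; lia.
  by case: HL => *; split; ev; frames.
have -> : v.1 == accept A by apply/eqP; apply: val_inj => /=; lia.
run; split; last by extension.
by case: HL => HQ HT HS *; split; ev; rewrite ?addn0 ?HS //= eqxx.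
Qed.

(** * Successors along transitions *)

Definition fire : cmd :=
  Do [:: BPut a_queue v_tail v_tgt; BAddc v_j v_beta 0; BAddc v_k v_tail 1;
         BAddc v_cnt v_nx 0] ;;
  decode_values ;;
  commit.

(** Both circuits are run in any case, which keeps the code pointer in step. Subtracting the
    distance between the state and the source from the guard bit merges the two conditions into one
    test. *)
Definition trans_loop : cmd :=
  While v_cnt2
    (Do [:: BGet v_src a_code v_tp; BAddc v_tp v_tp 1; BGet v_tgt a_code v_tp;
            BAddc v_tp v_tp 1] ;;
     run_circuit ;;
     Do [:: BGet v_o a_code v_tp; BAddc v_tp v_tp 1; BGet v_gv a_wire v_o] ;;
     run_circuit ;;
     Do [:: BGet v_q a_queue v_head; BSub v_d v_q v_src; BSub v_e v_src v_q;
            BAdd v_d v_d v_e; BSub v_gv v_gv v_d] ;;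
     If v_gv fire (Do [:: BAdd v_tp v_tp v_n]) ;;
     Do [:: BSubc v_cnt2 v_cnt2 1]).

Definition expand : cmd :=
  Do [:: BAddc v_j v_beta 0; BAddc v_k v_head 1; BAddc v_cnt v_nx 0; BSet v_wp 0] ;;
  emit_wires ;;
  Do [:: BAddc v_n v_wp 0; BAddc v_tp v_trans 0; BAddc v_cnt2 v_ntrans 0] ;;
  trans_loop.

Section Expand.
Variable A : automaton.
Implicit Types (v : node A) (st : seq (node A) * bool).

Definition enabled v (d : transition (nstates A) (beta A)) : bool :=
  (source d == v.1) && satisfies v.2 (guard d).

Definition successors v (ds : seq (transition (nstates A) (beta A))) : seq (node A) :=
  [seq (target d, act (action d) v.2) | d <- ds & enabled v d].

(* The stopwatches are charged only to transitions leaving the state of [v]: summed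
   over all nodes this gives a factor [bound A] instead of [nstates A * bound A]. *)
Definition trans_cost v (ds : seq (transition (nstates A) (beta A))) : nat :=
  sumn [seq 80 * size (code_transition d) + (source d == v.1) * (30 * nwatches A)
         | d <- ds].

Lemma size_push st v : size st.1 <= size (push st v).1.
Proof. by rewrite /push; case: ifP => //= _; case: ifP => // _; rewrite size_rcons. Qed.

(** Queue cells from the tail on belong to no node yet, so a tentative record may be written there,
    and later overwritten, without harm to the layer. *)
Lemma layer_queue_above s s' base K st :
  layer s base K st ->
  vars s' v_tail = vars s v_tail -> vars s' v_stamp = vars s v_stamp ->
  vars s' v_hit = vars s v_hit -> arr s' a_seen = arr s a_seen ->
  (forall i, i < vars s v_tail -> arr s' a_queue i = arr s a_queue i) ->
  layer s' base K st.
Proof.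
move=> HL Et Es Eh Ea Eq; case: HL => HQ HT HS H1 H2 H3 H4.
split=> //; rewrite ?Et ?Es ?Eh ?Ea //.
by apply: holds_eq HQ => i Hi; apply: Eq; rewrite HT -size_records; lia.
Qed.

Notation fire_vars := [:: v_j; v_k; v_cnt; v_m; v_b; v_o; v_tp; v_t; v_val; v_wt; 
  v_q; v_d; v_e; v_code; v_v; v_tail; v_hit] (only parsing).

Lemma fire_spec v (d : transition (nstates A) (beta A)) s base K st :
  ready A s -> layer s base K st -> vars s v_tgt = target d ->
  holds (arr s a_code) (vars s v_tp) (outs (action d)) ->
  carries s (outs (action d)) (eval_circuit (action d) (encode_assignment v.2)) ->
  wp fire s (fun s' =>
    [/\ layer s' base K (push st (target d, act (action d) v.2)),
        forall i, i < vars s v_tail -> arr s' a_queue i = arr s a_queue i,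
        vars s' v_tp = vars s v_tp + nbits A
      & extends fire_vars [:: a_seen; a_queue] s s' (inp s)
          (11 * nbits A + 22 * nwatches A + 25)]).
Proof.
have Eos : size (outs (action d)) = nbits A by rewrite size_tuple block_widthsE.
move=> HA HL Eg Ho Hc; apply: wp_seq; run; apply: wp_seq; apply: wp_mono.
  apply: (@decode_values_spec (betas A) (sumn (betas A)) _ (outs (action d))); ev.
  - exact: ready_halved HA.
  - exact: betas_le_sum.
  - by rewrite (parsed_nx HA) size_betas addn0.
  - by rewrite addn0; exact: (parsed_beta HA).
  - exact: Eos.
  - exact: Ho.
  - exact: Hc.
ev; rewrite Eos size_betas -values_act.
move=> s1 [Hq1 Lq1 Et1 [Fv1 Fa1 Ei1 Ec1]].
have Eqt : forall i, i < vars s v_tail -> arr s1 a_queue i = arr s a_queue i.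
  by move=> i Hi; rewrite Lq1 ?upd_other //; lia.
have F1 : frame work_vars (vars s) (vars s1) by extend_frame.
apply: wp_mono.
  apply: (@commit_spec A _ base K st (target d, act (action d) v.2)).
  - by apply: (ready_frame HA) => //; extend_frame.
  - by apply: (layer_queue_above HL); frames.
  - apply/holds_cons; frames; split; last by move: Hq1; rewrite addn1.
    by rewrite Lq1 ?addn1 // upd_same Eg.
move=> s2 [HL2 [Fv2 Fa2 Ei2 Ec2]]; split=> //.
- by move=> i Hi; frames; exact: Eqt.
- by frames.
- by extension; rewrite Ei2.
Qed.

Notation trans_vars := [:: v_src; v_tgt; v_gv; v_n; v_cnt2; v_g; v_op; v_x; v_y; v_i; 
  v_wq; v_j; v_k; v_cnt; v_m; v_b; v_o; v_tp; v_t; v_val; v_wt; v_q; v_d; v_e; v_code;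
  v_v; v_tail; v_hit] (only parsing).

Lemma trans_loop_spec v ds s base K st :
  ready A s -> layer s base K st ->
  arr s a_queue (vars s v_head) = v.1 -> vars s v_head < vars s v_tail ->
  wired s (encode_assignment v.2) -> vars s v_n = nbits A ->
  vars s v_cnt2 = size ds ->
  holds (arr s a_code) (vars s v_tp) (flatten (map (@code_transition _ _ _) ds)) ->
  wp trans_loop s (fun s' =>
    [/\ layer s' base K (foldl (@push A) st (successors v ds)),
        forall i, i < vars s v_tail -> arr s' a_queue i = arr s a_queue i
      & extends trans_vars work_arrays s s' (inp s) (trans_cost v ds + 1)]).
Proof.
have Enb : sumn (block_widths (beta A)) = nbits A by rewrite block_widthsE.
elim: ds s st => [|d ds IH] s st HA HL Eq Hht Hw En Ec.
  by move=> _; apply: wp_while_done => //; split; [by case: HL => *; split|by []|extension].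
set rst := flatten (map (@code_transition _ _ _) ds).
set cg := code_circuit (guard d); set ca := code_circuit (action d).
have Ecd : code_transition d = [:: nat_of_ord (source d), nat_of_ord (target d) & cg ++ ca].
  by [].
have -> : flatten (map (@code_transition _ _ _) (d :: ds)) =
    [:: nat_of_ord (source d), nat_of_ord (target d) & cg ++ ca ++ rst].
  by rewrite /= -catA.
move=> /holds_cons[Esrc /holds_cons[Etgt /holds_cat[Hg /holds_cat[Ha Hr]]]].
apply: wp_while_step; first by rewrite Ec.
apply: wp_seq; run; apply: wp_seq; apply: wp_mono.
  apply: (@run_circuit_spec _ _ (guard d) (encode_assignment v.2)); ev => //.
  - exact: size_encode_assignment.
  - by rewrite !addn1.
  - by rewrite En size_encode_assignment.
ev; rewrite !addn1 => s1 [Hw1 Hc1 Et1 Ho1 [Fv1 Fa1 Ei1 Ec1]].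
have Egv : arr s1 a_wire (arr s a_code (vars s1 v_tp)) = satisfies v.2 (guard d).
  rewrite /satisfies; move: Hc1 Ho1; frames.
  rewrite /carries; case: (outs (guard d)) (eval_circuit _ _) => -[//|o [|//]] //= _ us.
  by case: us => // u [|//] /= [Hu] /holds_cons[-> _].
apply: wp_seq; run; apply: wp_seq; apply: wp_mono.
  apply: (@run_circuit_spec _ _ (action d) (encode_assignment v.2)); ev => //.
  - exact: size_encode_assignment.
  - by frames; rewrite Et1.
  - by frames; rewrite En size_encode_assignment.
ev; rewrite Et1 => s2 [Hw2 Hc2 Et2 Ho2 [Fv2 Fa2 Ei2 Ec2]].
apply: wp_seq; run; apply: wp_seq.
have Eos : size (outs (action d)) = nbits A by rewrite size_tuple block_widthsE.
rewrite [X in _ + X = _]Enb in Et2.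
have FV2 : frame work_vars (vars s) (vars s2) by extend_frame.
have FA2 : frame work_arrays (arr s) (arr s2) by extend_frame.
(* The action has one output per bit of an assignment, so its code pays for all costs per bit; only
   the costs per stopwatch need a separate charge. *)
have En2 : nbits A <= size ca.
  by rewrite /ca /= size_cat /= Eos; lia.
(* A common postcondition of both branches: the pointer ends past the outputs of the action, moved
   by decoding them or by skipping [v_n] entries. *)
apply: (@wp_mono _ _ (fun s' => [/\ 
   layer s' base K (if enabled v d then push st (target d, act (action d) v.2) else st),
   forall i, i < vars s2 v_tail -> arr s' a_queue i = arr s2 a_queue i,
   vars s' v_tp = vars s2 v_tp + nbits A
   & extends (v_gv :: fire_vars) [:: a_seen; a_queue] s2 s' (inp s2)
          (11 * nbits A + (source d == v.1) * (22 * nwatches A) + 35)])).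
  apply: wp_if; ev; frames; rewrite Egv Eq Esrc => H.
    have [Es Hs] : source d = v.1 /\ satisfies v.2 (guard d).
      move: H; case: satisfies; last by rewrite sub0n.
      by move=> H; split=> //; apply: val_inj => /=; lia.
    rewrite /enabled Es eqxx Hs.
    apply: wp_mono.
      apply: (@fire_spec v d _ base K st).
      - by apply: (ready_frame HA); ev => //; extend_frame.
      - by apply: (layer_queue_above HL); ev => //; frames => //; extend_frame.
      - by ev; frames.
      - by ev; move: Ho2; frames.
      - exact: Hc2.
    move=> s3 [HL3 Eq3 Et3 [Fv3 Fa3 Ei3 Ec3]].
    split; [exact: HL3|by move: Eq3; ev; frames|exact: Et3|extension].
  have -> : enabled v d = false.
    rewrite /enabled; case: eqP H => // -> /=; rewrite !subnn; case: satisfies => //.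
  run; split.
  - by apply: (layer_queue_above HL); ev => //; frames => //; extend_frame.
  - by frames.
  - by frames; rewrite En.
  - extension.
move=> s3 [HL3 Eq3 Et3 [Fv3 Fa3 Ei3 Ec3]]; run.
have Etl : vars s v_tail <= vars s3 v_tail.
  rewrite (layer_tail HL) (layer_tail HL3) leq_add2l leq_mul2r orbC.
  by case: ifP; rewrite ?leqnn // size_push.
have EQ : forall i, i < vars s v_tail -> arr s3 a_queue i = arr s a_queue i.
  by move=> i Hi; rewrite Eq3; frames.
apply: wp_mono.
  apply: (IH _ (if enabled v d then push st (target d, act (action d) v.2) else st)); ev.
  - by apply: (ready_frame HA); ev; extend_frame.
  - by apply: (layer_queue_above HL3); ev => //; extend_frame.
  - by frames; rewrite EQ.
  - by frames; lia.
  - by rewrite /wired; ev; frames.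
  - by frames.
  - by frames; rewrite Ec subn1.
  - by frames; rewrite Et3; apply: (eq_ind _ (holds _ ^~ _) Hr); rewrite Et2.
move=> s4 [HL4 Eq4 [Fv4 Fa4 Ei4 Ec4]]; split.
- by move: HL4; rewrite /successors /=; case: (enabled v d).
- by move=> i Hi; rewrite Eq4; ev; [exact: EQ|lia].
- extension; ev_all; rewrite ?Ei4 ?Ei3 ?Ei2 //.
  have -> : trans_cost v (d :: ds) = 80 * (2 + (size cg + size ca)) +
      (source d == v.1) * (30 * nwatches A) + trans_cost v ds by rewrite -size_cat.
  rewrite -/cg in Ec1; rewrite -/ca in Ec2.
  by case: (source d == v.1) Ec3; lia.
Qed.

End Expand.

Notation inner_vars := [:: v_val; v_wt; v_flag; v_bit; v_cnt; v_cnt2; v_i; v_j; v_k; v_t;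
  v_b; v_v; v_h; v_code; v_wp; v_o; v_tp; v_m; v_n; v_g; v_op; v_x; v_y; v_wq; v_q;
  v_d; v_e; v_src; v_tgt; v_gv; v_p; v_a; v_hit; v_tail] (only parsing).

Lemma expand_spec A (v : node A) s base K st :
  ready A s -> layer s base K st ->
  holds (arr s a_queue) (vars s v_head) (node_record v) ->
  vars s v_head < vars s v_tail ->
  wp expand s (fun s' =>
    [/\ layer s' base K (foldl (@push A) st (successors v (transitions A))),
        forall i, i < vars s v_tail -> arr s' a_queue i = arr s a_queue i
      & extends inner_vars work_arrays s s' (inp s)
          (8 * nbits A + 7 * nwatches A + trans_cost v (transitions A) + 10)]).
Proof.
move=> HA HL /holds_cons[Eq Hv] Hht; apply: wp_seq; run; apply: wp_seq; apply: wp_mono.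
  apply: (@emit_wires_spec (betas A) (values v.2) (sumn (betas A)) _ [::]); ev => //.
  - by rewrite size_betas size_values.
  - exact: ready_halved HA.
  - exact: betas_le_sum.
  - exact: values_le_sum.
  - by rewrite (parsed_nx HA) size_betas addn0.
  - by rewrite addn0; exact: (parsed_beta HA).
  - by rewrite addn1.
ev; rewrite -encode_assignmentE -/(nbits A) size_betas cat0s add0n.
move=> s1 [Hw1 Ew1 [Fv1 Fa1 Ei1 Ec1]]; apply: wp_seq; run; apply: wp_mono.
  apply: (@trans_loop_spec A v (transitions A) _ base K st); ev.
  - by apply: (ready_frame HA); ev; extend_frame.
  - by apply: (layer_queue_above HL); ev; frames => //; extend_frame.
  - by frames.
  - by frames.
  - exact: Hw1.
  - by rewrite Ew1 addn0.
  - by frames; rewrite addn0 (parsed_ntrans HA).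
  - by frames; rewrite addn0; exact: (parsed_trans HA).
move=> s2; ev; frames => -[HL2 Eq2 [Fv2 Fa2 Ei2 Ec2]]; split=> //.
by extension; rewrite Ei2.
Qed.

(** * Successors along time edges *)

Definition copy_loop : cmd :=
  While v_cnt (Do [:: BGet v_t a_queue v_j; BPut a_queue v_k v_t; BAddc v_j v_j 1;
                      BAddc v_k v_k 1; BSubc v_cnt v_cnt 1]).

Definition bump_watch : cmd :=
  Do [:: BAdd v_a v_head v_x; BAddc v_a v_a 1; BGet v_t a_queue v_a; BAddc v_t v_t 1;
         BAdd v_j v_beta v_x; BGet v_b a_code v_j; BSub v_d v_t v_b; BSub v_t v_t v_d;
         BAdd v_a v_tail v_x; BAddc v_a v_a 1; BPut a_queue v_a v_t].

Definition pairs_loop : cmd :=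
  While v_cnt
    (Do [:: BGet v_x a_code v_p; BAddc v_p v_p 1; BGet v_y a_code v_p; BAddc v_p v_p 1;
            BSub v_d v_y v_q; BSub v_e v_q v_y; BAdd v_d v_d v_e] ;;
     If v_d (Do [::]) bump_watch ;;
     Do [:: BSubc v_cnt v_cnt 1]).

Definition tick_node : cmd :=
  Do [:: BGet v_q a_queue v_head; BAddc v_t v_q 5; BGet v_t a_code v_t;
         BSub v_d v_t v_letter; BSub v_e v_letter v_t; BAdd v_d v_d v_e] ;;
  If v_d (Do [::])
    (Do [:: BAddc v_j v_head 0; BAddc v_k v_tail 0; BAddc v_cnt v_nx 1] ;;
     copy_loop ;;
     Do [:: BAddc v_p v_pairs 0; BAddc v_cnt v_npairs 0] ;;
     pairs_loop ;;
     commit).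

Lemma copy_loop_spec l s :
  vars s v_cnt = size l -> holds (arr s a_queue) (vars s v_j) l ->
  vars s v_j + size l <= vars s v_k ->
  wp copy_loop s (fun s' =>
    [/\ holds (arr s' a_queue) (vars s v_k) l,
        forall i, i < vars s v_k -> arr s' a_queue i = arr s a_queue i
      & extends [:: v_cnt; v_t; v_j; v_k] [:: a_queue] s s' (inp s) (6 * size l + 1)]).
Proof.
elim: l s => [|x l IH] s Ec.
  by move=> _ _; apply: wp_while_done => //; split=> //; extension.
move=> /holds_cons[Ex Hl] /= Hjk; apply: wp_while_step; first by rewrite Ec.
run; apply: wp_mono; first apply: IH; ev.
- by rewrite Ec subn1.
- by rewrite addn1; apply: holds_eq Hl => i Hi; rewrite upd_other //; lia.
- by lia.
move=> s1 [Hl1 Eq1 [Fv1 Fa1 Ei1 Ec1]]; split.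
- apply/holds_cons; split; last by rewrite addn1 in Hl1.
  by rewrite Eq1 ?addn1 // upd_same.
- by move=> i Hi; rewrite Eq1 ?upd_other //; lia.
- by extension; ev_all; rewrite /=; lia.
Qed.

(** The increment is computed from the record at the head and not from its copy at the tail, so
    repeated pairs do no harm and only membership in [l] matters. *)
Lemma pairs_loop_spec A (v : node A) (l : seq ('I_(nwatches A) * 'I_(nstates A))) s :
  ready A s -> vars s v_cnt = size l ->
  holds (arr s a_code) (vars s v_p)
    (flatten [seq [:: nat_of_ord p.1; nat_of_ord p.2] | p <- l]) ->
  holds (arr s a_queue) (vars s v_head) (node_record v) -> vars s v_q = v.1 ->
  vars s v_head + (nwatches A).+1 <= vars s v_tail ->
  wp pairs_loop s (fun s' =>
    [/\ forall x : 'I_(nwatches A), arr s' a_queue (vars s v_tail + x + 1) =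
          if (x, v.1) \in l then minn (v.2 x + 1) (beta A x)
          else arr s a_queue (vars s v_tail + x + 1),
        forall i, i <= vars s v_tail -> arr s' a_queue i = arr s a_queue i
      & extends [:: v_cnt; v_p; v_x; v_y; v_d; v_e; v_a; v_t; v_j; v_b] [:: a_queue] s s'
          (inp s) (21 * size l + 1)]).
Proof.
elim: l s => [|[y q] l IH] s HA Ec.
  by move=> _ _ _ _; apply: wp_while_done => //; split=> //; extension.
move=> /holds_cons[Ey /holds_cons[Eq Hp]] /[dup] Hhd /holds_cons[_ Hv] Ecq Hht.
apply: wp_while_step; first by rewrite Ec.
apply: wp_seq; run; apply: wp_seq.
apply: (@wp_mono _ _ (fun s' =>
    [/\ forall x : 'I_(nwatches A), arr s' a_queue (vars s v_tail + x + 1) =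
          if (x, v.1) == (y, q) then minn (v.2 x + 1) (beta A x)
          else arr s a_queue (vars s v_tail + x + 1),
        forall i, i <= vars s v_tail -> arr s' a_queue i = arr s a_queue i,
        vars s' v_p = vars s v_p + 2
      & extends [:: v_p; v_x; v_y; v_d; v_e; v_a; v_t; v_j; v_b] [:: a_queue] s s'
          (inp s) 20])).
  rewrite /= in Eq Ey Hp; apply: wp_if; ev; rewrite addn1 Eq Ecq Ey => H.
    have Nq : v.1 != q by apply/eqP => E; rewrite E subnn in H.
    run; split=> //; [|by rewrite addn1 addn2|extension].
    by move=> x; rewrite xpair_eqE (negPf Nq) andbF.
  have Eqq : v.1 = q by apply: val_inj => /=; lia.
  run; rewrite !addn1.
  have EB : arr s a_code (vars s v_beta + y) = beta A y.
    by rewrite (parsed_beta HA) ?nth_betas // size_betas.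
  have EV : arr s a_queue (vars s v_head + y).+1 = v.2 y.
    by rewrite -addSn Hv ?nth_values // size_values.
  rewrite EB EV; split.
  - move=> x; rewrite !addn1 xpair_eqE Eqq eqxx andbT.
    case: (eqVneq x y) => [->|Nx]; first by rewrite upd_same; lia.
    by rewrite upd_other // => E; case/eqP: Nx; apply: val_inj => /=; lia.
  - by move=> i Hi; rewrite upd_other //; lia.
  - by rewrite addn2.
  - extension.
move=> s1 [Hx1 Hi1 Ep1 [Fv1 Fa1 Ei1 Ec1]]; run; apply: wp_mono.
  apply: IH; ev; frames => //.
  - by apply: (ready_frame HA); ev; extend_frame.
  - by rewrite Ec subn1.
  - by rewrite Ep1 addn2.
  - apply: holds_eq Hhd => i; rewrite size_node_record => Hi; apply: Hi1; lia.
move=> s2; ev; frames => -[Hx2 Hi2 [Fv2 Fa2 Ei2 Ec2]]; split.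
- by move=> x; rewrite Hx2 Hx1 inE; case: (_ == _); case: (_ \in _).
- by move=> i Hi; rewrite Hi2 // Hi1.
- by extension; ev_all; rewrite ?Ei2 //=; lia.
Qed.

Lemma values_elapse A (v : node A) (x : 'I_(nwatches A)) :
  nth 0 (values (elapse v.1 1 v.2)) x =
  if (x, v.1) \in active A then minn (v.2 x + 1) (beta A x) else v.2 x.
Proof.
rewrite nth_values ffunE inordK ?ltnS ?geq_minr //.
by case: ifP => // _; apply/minn_idPl; rewrite -ltnS ltn_ord.
Qed.

Lemma tick_node_spec A (v : node A) s base K st :
  ready A s -> layer s base K st ->
  holds (arr s a_queue) (vars s v_head) (node_record v) ->
  vars s v_head + (nwatches A).+1 <= vars s v_tail ->
  wp tick_node s (fun s' =>
    [/\ layer s' base K (if vars s v_letter == label A v.1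
                         then push st (v.1, elapse v.1 1 v.2) else st),
        forall i, i < vars s v_tail -> arr s' a_queue i = arr s a_queue i
      & extends inner_vars work_arrays s s' (inp s)
          (3 * nbits A + 14 * nwatches A + 21 * #|active A| + 60)]).
Proof.
move=> HA HL /[dup] Hhd /holds_cons[Eq Hv] Hht; apply: wp_seq; run.
have El : arr s a_code (v.1 + 5) = label A v.1.
  rewrite addnC (parsed_labels HA) ?size_labels //.
  by rewrite (nth_map v.1) ?size_enum_ord // nth_ord_enum.
apply: wp_if; ev; rewrite Eq El => H.
  have -> : (vars s v_letter == label A v.1) = false by apply/eqP => E; lia.
  run; split=> //; last by extension.
  by apply: (layer_queue_above HL); ev => //; extend_frame.
have -> : vars s v_letter == label A v.1 by apply/eqP; lia.
apply: wp_seq; run; apply: wp_seq; apply: wp_mono.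
  apply: (@copy_loop_spec (node_record v)); ev.
  - by rewrite size_node_record (parsed_nx HA) addn1.
  - by rewrite addn0.
  - by rewrite size_node_record !addn0.
ev; rewrite size_node_record addn0 => s1 [Hc1 Hi1 [Fv1 Fa1 Ei1 Ec1]].
apply: wp_seq; run; apply: wp_seq; apply: wp_mono.
  apply: (@pairs_loop_spec A v (enum (active A))); ev; frames => //.
  - by apply: (ready_frame HA); ev; extend_frame.
  - by rewrite addn0 (parsed_npairs HA) cardE.
  - by rewrite addn0; exact: (parsed_pairs HA).
  - apply: holds_eq Hhd => i; rewrite size_node_record => Hi; apply: Hi1; lia.
have Esz : size (enum (active A)) = #|active A| by rewrite cardE.
ev; frames; rewrite Esz => s2 [Hx2 Hi2 [Fv2 Fa2 Ei2 Ec2]].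
have Hi : forall i, i < vars s v_tail -> arr s2 a_queue i = arr s a_queue i.
  by move=> i Hi; rewrite Hi2 ?Hi1 // ltnW.
apply: wp_mono.
  apply: (@commit_spec A _ base K st (v.1, elapse v.1 1 v.2)).
  - by apply: (ready_frame HA); ev; extend_frame.
  - by apply: (layer_queue_above HL); ev; frames => //; extend_frame.
  - have /holds_cons[Hc0 Hc] := Hc1.
    apply/holds_cons; frames; split; first by rewrite Hi2.
    move=> i; rewrite size_values => Hin; pose x := Ordinal Hin.
    have -> : (vars s v_tail).+1 + i = vars s v_tail + x + 1 by rewrite addSn addn1.
    rewrite Hx2 -[i]/(nat_of_ord x) (values_elapse v) mem_enum; case: ifP => // _.
    by rewrite addn1 -addSn Hc ?size_values // nth_values.
move=> s3 [HL3 [Fv3 Fa3 Ei3 Ec3]]; split=> //.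
- by move=> i Hlt; frames; exact: Hi.
- by extension; ev_all; rewrite ?Ei3 ?Ei2 ?Ei1.
Qed.

(** * Layered reachability *)

Section Reach.
Variables (A : automaton) (w : seq 'I_(nletters A)).
Implicit Types (u v : node A) (st : seq (node A) * bool).

Definition initial_node : node A := (start A, zero_assignment A).

Definition tick1 v : node A := (v.1, elapse v.1 1 v.2).

(** The layers in the form in which the machine finds them: [k] counts the letters read, runs grow
    at their end rather than at their front, and time passes in units. *)
Inductive reach : nat -> node A -> Prop :=
  | ReachInit : reach 0 initial_node
  | ReachFire k v d : reach k v -> v.1 != accept A -> List.In d (transitions A) ->
      enabled v d -> reach k (target d, act (action d) v.2)
  | ReachTick k v : reach k v -> v.1 != accept A -> onth w k = Some (label A v.1) ->
      reach k.+1 (tick1 v).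

Lemma mem_successors v ds u : u \in successors v ds <->
  exists d, [/\ List.In d ds, enabled v d & u = (target d, act (action d) v.2)].
Proof.
rewrite /successors; elim: ds => [|d ds IH]; first by split=> // -[d []].
rewrite [filter _ _]/=; case: ifP => Hd; last first.
  rewrite IH; split=> -[d' [H1 H2 H3]]; exists d'; first by split=> //; right.
  by split=> //; case: H1 => // E; rewrite E H2 in Hd.
rewrite [map _ _]/= inE; split.
  case/orP=> [/eqP->|/IH [d' [H1 H2 H3]]]; first by exists d; split=> //; left.
  by exists d'; split=> //; right.
case=> d' [H1 H2 H3]; apply/orP; case: H1 => [E|H1]; first by left; rewrite H3 E.
by right; apply/IH; exists d'.
Qed.

Lemma computation_rcons (s s' s'' : node A) (u : seq 'I_(nletters A)) t :
  computation s u s' -> s'.1 != accept A -> edge s' t s'' ->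
  computation s (u ++ nseq t (label A s'.1)) s''.
Proof.
elim=> {s u s'} [s|s s1 s2 t' u Hs He _ IH] Hs' He'.
  by rewrite cat0s -[nseq _ _]cats0; apply: CompCons He' (CompNil _).
by rewrite -catA; apply: CompCons He (IH Hs' He').
Qed.

Lemma elapse0 (q : 'I_(nstates A)) (xi : assignment A) : elapse q 0 xi = xi.
Proof.
apply/ffunP => x; apply: val_inj; rewrite ffunE /= inordK ?ltnS ?geq_minr //.
by rewrite addn0 if_same; apply/minn_idPl; rewrite -ltnS ltn_ord.
Qed.

(** Capping after every unit step has the same effect as capping once at the end; this is what
    splits a time edge into unit edges. *)
Lemma elapseS (q : 'I_(nstates A)) t (xi : assignment A) :
  elapse q t.+1 xi = elapse q 1 (elapse q t xi).
Proof.
apply/ffunP => x; apply: val_inj; rewrite !ffunE /= !inordK ?ltnS ?geq_minr //.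
by case: ifP => _; lia.
Qed.

Lemma reach_sound k v : reach k v -> computation initial_node (take k w) v.
Proof.
elim=> {k v} [|k v d _ IH Hv Hd /andP[/eqP Es Hg]|k v _ IH Hv Ho].
- by rewrite take0; exact: CompNil.
- case: v Hv IH Es Hg => q xi /= Hq IH Es Hg; subst q.
  have := computation_rcons IH Hq (EdgeTransition Hd Hg).
  by rewrite cats0.
- have -> : take k.+1 w = take k w ++ nseq 1 (label A v.1).
    have Hk : k < size w.
      by rewrite ltnNge; apply/negP => H; rewrite onth_default in Ho.
    by rewrite (take_nth (label A v.1)) // (onth_nth _ _ _ _ Ho) -cats1.
  by apply: (computation_rcons IH Hv); case: (v) => q xi; exact: EdgeTime.
Qed.

Lemma reach_elapse k (q : 'I_(nstates A)) (xi : assignment A) t :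
  reach k (q, xi) -> q != accept A -> prefix (nseq t (label A q)) (drop k w) ->
  reach (k + t) (q, elapse q t xi).
Proof.
move=> Hr Hq; elim: t => [|t IH] Hp; first by rewrite addn0 elapse0.
move/prefixP: Hp => [r Er].
have Ht : reach (k + t) (q, elapse q t xi).
  apply: IH; apply/prefixP; exists (label A q :: r).
  by rewrite Er -addn1 nseqD -catA.
rewrite elapseS addnS; apply: (ReachTick Ht) => //=.
have Eo : onth (drop k w) t = Some (label A q).
  by rewrite Er onth_cat size_nseq ltnSn onth_nseq ltnSn.
by move: Eo; rewrite !onthE map_drop nth_drop.
Qed.

Lemma reach_complete (s s' : node A) (u : seq 'I_(nletters A)) : computation s u s' ->
  forall k, reach k s -> prefix u (drop k w) -> reach (k + size u) s'.
Proof.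
elim=> {s u s'} [s|s s1 s2 t u Hs He _ IH] k Hr; first by rewrite addn0.
move=> /prefixP[r Er]; rewrite size_cat size_nseq addnA; apply: IH; last first.
  apply/prefixP; exists r; rewrite addnC -drop_drop Er -catA drop_size_cat ?size_nseq //.
case: He Hs Hr Er => [d xi Hd Hg|q xi t' Ht'] Hs Hr Er.
  rewrite addn0; apply: (ReachFire Hr Hs Hd); rewrite /enabled eqxx; exact: Hg.
by apply: reach_elapse => //; apply/prefixP; exists (u ++ r); rewrite Er -catA.
Qed.

Lemma reach_language : language A w <-> exists xi, reach (size w) (accept A, xi).
Proof.
split=> -[xi H]; exists xi.
  have := reach_complete H ReachInit; rewrite add0n drop0; apply; exact: prefix_refl.
by have := reach_sound H; rewrite take_size.
Qed.

(** * Layers computed by pushing *)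

(** One flag can stand for all accepting nodes: computations never leave them, and the language does
    not depend on the assignment at acceptance. *)
Definition covers st v : bool := if v.1 == accept A then st.2 else v \in st.1.

Record sound (k : nat) st : Prop := Sound {
  sound_uniq : uniq st.1;
  sound_live : forall v, v \in st.1 -> v.1 != accept A;
  sound_reach : forall v, v \in st.1 -> reach k v;
  sound_hit : st.2 -> exists xi, reach k (accept A, xi)
}.

Definition exact_layer (k : nat) st : Prop :=
  sound k st /\ forall v, reach k v -> covers st v.

Lemma push_prefix st v : exists l, (push st v).1 = st.1 ++ l.
Proof.
rewrite /push; case: ifP => _ /=; first by exists [::]; rewrite cats0.
by case: ifP => _; [exists [::]; rewrite cats0|exists [:: v]; rewrite cats1].
Qed.

Lemma foldl_push_prefix st vs : exists l, (foldl (@push A) st vs).1 = st.1 ++ l.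
Proof.
elim: vs st => [|v vs IH] st /=; first by exists [::]; rewrite cats0.
have [l1 E1] := push_prefix st v; have [l2 ->] := IH (push st v).
by exists (l1 ++ l2); rewrite E1 catA.
Qed.

Lemma covers_push_self st v : covers (push st v) v.
Proof.
rewrite /covers /push; case: (eqVneq v.1) => //= _.
by case: ifP => // _; rewrite mem_rcons mem_head.
Qed.

Lemma covers_push st v u : covers st u -> covers (push st v) u.
Proof.
rewrite /covers /push; case: (eqVneq u.1) => _; case: (eqVneq v.1) => //= _.
by case: ifP => // _; rewrite mem_rcons inE orbC => ->.
Qed.

Lemma covers_foldl_push st vs u :
  covers st u || (u \in vs) -> covers (foldl (@push A) st vs) u.
Proof.
elim: vs st => [|v vs IH] st /=; first by rewrite orbF.
rewrite inE => H; apply: IH; case/or3P: H => [H|/eqP->|->]; last by rewrite orbT.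
  by rewrite covers_push.
by rewrite covers_push_self.
Qed.

Lemma sound_push k st v : sound k st -> reach k v -> sound k (push st v).
Proof.
case=> H1 H2 H3 H4 Hr; rewrite /push; case: eqP => [E|/eqP N].
  by split=> // _; exists v.2; rewrite -E; case: (v) Hr.
case: ifP => Hv; first by split.
split=> //=; first by rewrite rcons_uniq Hv.
  by move=> u; rewrite mem_rcons inE => /orP[/eqP->|/H2].
by move=> u; rewrite mem_rcons inE => /orP[/eqP->|/H3].
Qed.

Lemma sound_foldl_push k st vs :
  sound k st -> (forall v, v \in vs -> reach k v) -> sound k (foldl (@push A) st vs).
Proof.
elim: vs st => //= v vs IH st Hs Hr; apply: IH.
  by apply: sound_push => //; apply: Hr; exact: mem_head.
by move=> u Hu; apply: Hr; rewrite inE Hu orbT.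
Qed.

(** The nodes through which layer [k] is entered; every other node of the layer arises from these by
    transitions. *)
Definition seed (k : nat) v : Prop :=
  match k with
  | 0 => v = initial_node
  | k'.+1 => exists u, [/\ reach k' u, u.1 != accept A,
                          onth w k' = Some (label A u.1) & v = tick1 u]
  end.

Lemma closed_covers k st :
  (forall v, seed k v -> covers st v) ->
  (forall v, v \in st.1 -> forall u, u \in successors v (transitions A) -> covers st u) ->
  forall v, reach k v -> covers st v.
Proof.
move=> Hseed Hcl v Hr; elim: Hr Hseed => {k v} [|k v d _ IH Hv Hd He|k v Hr _ Hv Ho] Hseed.
- exact: Hseed.
- apply: (Hcl v); last by apply/mem_successors; exists d.
  by have := IH Hseed; rewrite /covers (negPf Hv).
- by apply: Hseed; exists v.
Qed.

End Reach.

(** * The decision procedure *)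

Notation v_ans := 0 (only parsing).

Definition closure_loop : cmd :=
  While v_w (expand ;; Do [:: BAdd v_head v_head v_nx; BAddc v_head v_head 1;
                              BSub v_w v_tail v_head]).

Definition closure : cmd := Do [:: BSub v_w v_tail v_head] ;; closure_loop.

Definition tick_loop : cmd :=
  While v_w (tick_node ;; Do [:: BAdd v_head v_head v_nx; BAddc v_head v_head 1;
                                 BSub v_w v_lim v_head]).

(** The finished layer lies in the queue between [v_base] and [v_lim]. It is read once more for the
    unit time steps while the next layer grows from [v_lim] on; when that ends, the head stands at
    [v_lim], ready for the closure of the new layer. *)
Definition letter_loop : cmd :=
  While v_left
    (read_nat ;;
     Do [:: BAddc v_letter v_val 0; BAddc v_lim v_tail 0; BAddc v_head v_base 0;
            BAddc v_stamp v_stamp 1; BSub v_w v_lim v_head] ;;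
     tick_loop ;;
     Do [:: BAddc v_base v_lim 0] ;;
     closure ;;
     Do [:: BSubc v_left v_left 1]).

(** Stamps start at 1 because fresh memory reads 0 and must not look visited; layer [k] therefore
    has stamp [k.+1]. *)
Definition decide : cmd :=
  parse ;;
  half_table ;;
  read_nat ;;
  Do [:: BAddc v_left v_val 0; BSet v_stamp 1; BSet v_t 3; BGet v_t a_code v_t;
         BPut a_queue v_tail v_t] ;;
  commit ;;
  closure ;;
  letter_loop ;;
  Do [:: BSub v_t v_stamp v_hit; BSet v_ans 1; BSub v_ans v_ans v_t].

Notation loop_vars := [:: v_head; v_w; v_val; v_wt; v_flag; v_bit; v_cnt; v_cnt2; v_i;
  v_j; v_k; v_t; v_b; v_v; v_h; v_code; v_wp; v_o; v_tp; v_m; v_n; v_g; v_op; v_x; v_y;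
  v_wq; v_q; v_d; v_e; v_src; v_tgt; v_gv; v_p; v_a; v_hit; v_tail] (only parsing).

Section Decide.
Variables (A : automaton) (w : seq 'I_(nletters A)).
Implicit Types (u v : node A) (st : seq (node A) * bool).

(** The 14 is the constant 10 of [expand_spec] plus 4 ticks of the closure loop; likewise 64 is 60
    plus 4 in [tick_cost]. *)
Definition node_cost v : nat :=
  8 * nbits A + 7 * nwatches A + trans_cost v (transitions A) + 14.

Definition tick_cost : nat := 3 * nbits A + 14 * nwatches A + 21 * #|active A| + 64.

Lemma layer_holds_nth s base K st dn v td :
  layer s base K st -> st.1 = dn ++ v :: td ->
  holds (arr s a_queue) (base + size dn * (nwatches A).+1) (node_record v) /\
  base + (size dn).+1 * (nwatches A).+1 + size td * (nwatches A).+1 = vars s v_tail.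
Proof.
move=> HL E; split.
  have := layer_queue HL; rewrite E map_cat flatten_cat holds_cat size_records.
  by case=> _ /holds_cat[].
by rewrite (layer_tail HL) E size_cat [size (_ :: _)]/= mulnDl !mulSn; lia.
Qed.

(** The nodes of [dn] have been expanded and those of [td] wait. The queue has no duplicates, so [n]
    bounds the expansions to come, and each node pays its cost when it moves to [dn]: this yields a
    sum over the nodes outside [dn]. *)
Lemma closure_loop_spec k n s base K st dn td :
  #|{: node A}| <= n + size dn -> ready A s -> layer s base K st ->
  st.1 = dn ++ td -> sound w k st ->
  vars s v_head = base + size dn * (nwatches A).+1 ->
  vars s v_w = vars s v_tail - vars s v_head ->
  (forall v, v \in dn -> forall u, u \in successors v (transitions A) -> covers st u) ->
  wp closure_loop s (fun s' => exists st',
    [/\ layer s' base K st', sound w k st',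
        forall u, covers st u -> covers st' u,
        forall v, v \in st'.1 ->
          forall u, u \in successors v (transitions A) -> covers st' u
      & extends loop_vars work_arrays s s' (inp s)
          (\sum_(v : node A | v \notin dn) node_cost v + 1)]).
Proof.
elim: n s st dn td => [|n IH] s st dn td Hn HA HL Est Hs Eh Ew Hdn.
  have U : uniq (dn ++ td) by rewrite -Est; exact: sound_uniq Hs.
  (* For [n = 0] the list [dn] already exhausts all nodes. *)
  have Etd : td = [::].
    have := max_card (mem (dn ++ td)).
    have -> : #|mem (dn ++ td)| = size (dn ++ td) by apply/card_uniqP.
    move=> /leq_trans/(_ Hn); rewrite size_cat add0n -{2}[size dn]addn0 leq_add2l leqn0.
    by move/nilP.
  subst td; rewrite cats0 in Est.
  apply: wp_while_done; first by rewrite Ew Eh (layer_tail HL) Est subnn.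
  exists st; split=> //; [by case: HL => *; split|by rewrite Est|extension].
case: td Est => [|v td] Est.
  rewrite cats0 in Est.
  apply: wp_while_done; first by rewrite Ew Eh (layer_tail HL) Est subnn.
  exists st; split=> //; [by case: HL => *; split|by rewrite Est|extension].
have [Hrec Etl] := layer_holds_nth HL Est.
have U : uniq (dn ++ v :: td) by rewrite -Est; exact: sound_uniq Hs.
have Vst : v \in st.1 by rewrite Est mem_cat mem_head orbT.
have Vdn : v \notin dn.
  by move: U; rewrite cat_uniq => /and3P[_ /hasPn H _]; apply: H; exact: mem_head.
apply: wp_while_step; first by rewrite Ew Eh; lia.
apply: wp_seq; apply: wp_mono.
  apply: (@expand_spec A v _ base K st); ev.
  - by case: HA => -[*]; split.
  - by case: HL => *; split.
  - by rewrite Eh.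
  - by rewrite Eh; lia.
set st1 := foldl _ _ _; move=> s1 [HL1 Eq1 [Fv1 Fa1 Ei1 Ec1]]; run.
have Hs1 : sound w k st1.
  apply: sound_foldl_push => // u /mem_successors[d [Hd He ->]].
  by apply: (ReachFire (sound_reach Hs Vst)) => //; exact: sound_live Hs _ Vst.
have [l El] := foldl_push_prefix st (successors v (transitions A)).
have Cov u : covers st u -> covers st1 u.
  by move=> H; apply: covers_foldl_push; rewrite H.
apply: wp_mono.
  apply: (IH _ st1 (rcons dn v) (td ++ l)); ev => //.
  - by rewrite size_rcons addnS -addSn.
  - by apply: (ready_frame HA); ev; extend_frame.
  - by case: HL1 => *; split.
  - by rewrite cat_rcons /st1 El Est -catA.
  - by frames; rewrite Eh (parsed_nx HA) size_rcons; lia.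
  - move=> u; rewrite mem_rcons inE => /orP[/eqP->|Hu] u' Hu'; last first.
      by apply: Cov; exact: Hdn Hu _ Hu'.
    by apply: covers_foldl_push; rewrite Hu' orbT.
move=> s2 [st2 [HL2 Hs2 Cov2 Cl2 [Fv2 Fa2 Ei2 Ec2]]].
exists st2; split=> //; first by move=> u /Cov/Cov2.
have Esum : \sum_(u : node A | u \notin dn) node_cost u =
    node_cost v + \sum_(u : node A | u \notin rcons dn v) node_cost u.
  rewrite (bigD1 v) //=; congr addn; apply: eq_bigl => u.
  by rewrite mem_rcons inE negb_or andbC.
rewrite Esum; extension; ev_all; rewrite ?Ei2 ?Ei1 //.
have En : node_cost v = 8 * nbits A + 7 * nwatches A +
  trans_cost v (transitions A) + 14 by [].
by lia.
Qed.

Definition closure_cost : nat := \sum_(v : node A) node_cost v + 2.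

Lemma closure_spec k s base K st :
  ready A s -> layer s base K st -> sound w k st ->
  (forall v, seed w k v -> covers st v) -> vars s v_head = base ->
  wp closure s (fun s' => exists st',
    [/\ layer s' base K st', exact_layer w k st'
      & extends loop_vars work_arrays s s' (inp s) closure_cost]).
Proof.
move=> HA HL Hs Hseed Eh; apply: wp_seq; run; apply: wp_mono.
  apply: (@closure_loop_spec k #|{: node A}| _ base K st [::] st.1); ev => //.
  - by rewrite addn0.
  - by apply: (ready_frame HA); ev; extend_frame.
  - by case: HL => *; split.
  - by rewrite addn0.
move=> s1 [st1 [HL1 Hs1 Cov Cl [Fv Fa Ei Ec]]]; exists st1; split=> //.
  split=> // v; apply: closed_covers => // u Hu; apply: Cov; exact: Hseed.
by rewrite /closure_cost; extension; ev_all; move: Ec; under eq_bigl do rewrite in_nil; lia.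
Qed.

Definition tick_push (a : nat) st v :=
  if a == label A v.1 then push st (tick1 v) else st.

(** The nodes [td] still to be advanced lie below [lim], the base of the new layer, so pushing
    cannot overwrite them. *)
Lemma tick_loop_spec s lim K st td :
  ready A s -> layer s lim K st -> vars s v_lim = lim ->
  holds (arr s a_queue) (vars s v_head) (flatten (map (@node_record A) td)) ->
  vars s v_head + size td * (nwatches A).+1 = lim ->
  vars s v_w = vars s v_lim - vars s v_head ->
  wp tick_loop s (fun s' =>
    [/\ layer s' lim K (foldl (tick_push (vars s v_letter)) st td),
        vars s' v_head = lim
      & extends loop_vars work_arrays s s' (inp s) (size td * tick_cost + 1)]).
Proof.
elim: td s st => [|v td IH] s st HA HL El Hq Eh Ew.
  rewrite addn0 in Eh.
  apply: wp_while_done; first by rewrite Ew El Eh subnn.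
  by split=> //; [case: HL => *; split|extension].
have /= := Hq; rewrite -[_ :: _]/(node_record v ++ _) => /holds_cat[Hv Htd].
rewrite size_node_record in Htd.
rewrite /= mulSn in Eh.
have Hle : lim <= vars s v_tail by rewrite (layer_tail HL) leq_addr.
apply: wp_while_step; first by rewrite Ew El; lia.
apply: wp_seq; apply: wp_mono.
  apply: (@tick_node_spec A v _ lim K st); ev => //.
  - by case: HA => -[*]; split.
  - by case: HL => *; split.
  - by lia.
ev; rewrite -/(tick1 v) -/(tick_push _ st v) => s1 [HL1 Eq1 [Fv1 Fa1 Ei1 Ec1]]; run.
apply: wp_mono.
  apply: (IH _ (tick_push (vars s v_letter) st v)); ev; frames => //.
  - by apply: (ready_frame HA); ev; extend_frame.
  - by case: HL1 => *; split.
  - rewrite (parsed_nx HA) -addnA addn1; apply: holds_eq Htd => i.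
    by rewrite size_records => Hi; apply: Eq1; lia.
  - by rewrite (parsed_nx HA); lia.
ev; frames => s2 [HL2 Eh2 [Fv2 Fa2 Ei2 Ec2]]; split=> //.
by extension; ev_all; rewrite ?Ei2 // mulSn /tick_cost; move: Ec2; rewrite /tick_cost; lia.
Qed.

End Decide.

Section Letters.
Variables (A : automaton) (w : seq 'I_(nletters A)).
Implicit Types (v : node A) (st : seq (node A) * bool).

Lemma foldl_tick_push a st td : foldl (@tick_push A a) st td =
  foldl (@push A) st [seq tick1 v | v <- td & a == label A v.1].
Proof.
elim: td st => //= v td IH st; rewrite IH /tick_push.
by case: ifP.
Qed.

(** The flag can restart at [false]: accepting nodes have no time steps, so the next layer is
    entered only from stored nodes. *)
Lemma tick_layer k (a : 'I_(nletters A)) st :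
  onth w k = Some a -> exact_layer w k st ->
  let st' := foldl (tick_push a) ([::], false) st.1 in
  sound w k.+1 st' /\ forall v, seed w k.+1 v -> covers st' v.
Proof.
move=> Ha [Hs Hc]; rewrite /= foldl_tick_push; split.
  apply: sound_foldl_push; first by split.
  move=> _ /mapP[v Hv ->]; move: Hv; rewrite mem_filter => /andP[/eqP/val_inj El Hv].
  apply: ReachTick; [exact: sound_reach Hs _ Hv|exact: sound_live Hs _ Hv|].
  by rewrite Ha El.
move=> _ [v [Hr Hv Hl ->]]; apply: covers_foldl_push; apply/orP; right.
apply: map_f; rewrite mem_filter; move: (Hc _ Hr); rewrite /covers (negPf Hv) => ->.
by move: Hl; rewrite Ha => -[->]; rewrite eqxx.
Qed.

Lemma leq_width m n : m <= n -> width m <= width n.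
Proof. by move=> H; apply: up_log_min => //; apply: leq_ltn_trans H (ltn_width n). Qed.

Lemma size_layer k st : sound w k st -> size st.1 <= #|{: node A}|.
Proof.
move=> Hs; have /card_uniqP <- := sound_uniq Hs; exact: max_card.
Qed.

Definition letter_cost : nat :=
  10 * size (encode_nat (nletters A)) + #|{: node A}| * tick_cost A + closure_cost A + 20.

Lemma letter_loop_spec (u : seq 'I_(nletters A)) k s base st :
  k + size u = size w -> drop k w = u -> ready A s -> layer s base k.+1 st ->
  exact_layer w k st -> vars s v_base = base -> vars s v_left = size u ->
  inp s = encode_nats (map (@nat_of_ord _) u) ->
  wp letter_loop s (fun s' => exists st' base',
    [/\ layer s' base' (size w).+1 st', exact_layer w (size w) st'
      & clk s' <= clk s + size u * letter_cost + 1]).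
Proof.
elim: u k s base st => [|a u IH] k s base st Ek Eu HA HL Hex Eb El Hi.
  apply: wp_while_done => //; rewrite addn0 in Ek; rewrite -Ek.
  by exists st, base; split=> //; [case: HL => *; split|ev; lia].
have Ha : onth w k = Some a.
  by have := congr1 (fun l => onth l 0) Eu; rewrite onthE map_drop nth_drop addn0 -onthE.
apply: wp_while_step; first by rewrite El.
apply: wp_seq; apply: wp_mono.
  by apply: (@read_nat_spec a _ (encode_nats (map (@nat_of_ord _) u))); ev; rewrite Hi.
move=> s1 [Ev1 [Fv1 Fa1 Ei1 Ec1]]; apply: wp_seq; run; rewrite !addn0 Ev1.
have Etl := layer_tail HL.
apply: wp_seq; apply: wp_mono.
  apply: (@tick_loop_spec A _ (vars s v_tail) k.+2 ([::], false) st.1); ev; frames => //.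
  - by apply: (ready_frame HA); ev; extend_frame.
  (* All old stamps are at most [k.+1], so none equals the new one, [k.+2], and the new layer starts
     empty. *)
  - split; ev; frames; rewrite ?addn0 ?addn1 //=.
    + by rewrite (layer_stamp HL).
    + by move=> v; apply: leq_trans (layer_seen_le HL v) _.
    + by move=> v; apply/negbTE; rewrite neq_ltn ltnS (layer_seen_le HL v).
    + exact: leq_trans (layer_hit_le HL) _.
    + by apply/negbTE; rewrite neq_ltn ltnS (layer_hit_le HL).
  - by rewrite Eb; exact: layer_queue HL.
  - by rewrite Eb Etl.
ev; frames; have [Hs2 Hseed2] := tick_layer Ha Hex; set st2 := foldl _ _ _ in Hs2 Hseed2 *.
move=> s2 [HL2 Eh2 [Fv2 Fa2 Ei2 Ec2]]; apply: wp_seq; run.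
apply: wp_seq; apply: wp_mono.
  apply: (@closure_spec A w k.+1 _ (vars s v_tail) k.+2 st2); ev => //.
  - by apply: (ready_frame HA); ev; extend_frame.
  - by case: HL2 => *; split.
move=> s3 [st3 [HL3 Hex3 [Fv3 Fa3 Ei3 Ec3]]]; run; apply: wp_mono.
  apply: (IH k.+1 _ (vars s v_tail) st3); ev; frames => //.
  - by rewrite addSnnS.
  - by rewrite -add1n -drop_drop Eu /= drop0.
  - by apply: (ready_frame HA); ev; extend_frame.
  - by case: HL3 => *; split.
  - by rewrite addn0.
  - by rewrite El subn1.
  - by rewrite Ei3; ev; rewrite Ei2.
move=> s4 [st4 [base4 [HL4 Hex4 Ec4]]]; exists st4, base4; split=> //.
have Hsz := size_layer Hex.1.
have Hsz2 : size st.1 * tick_cost A <= #|{: node A}| * tick_cost A by rewrite leq_mul2r Hsz orbT.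
(* A letter is smaller than [nletters A], whose code is part of that of the automaton; this bounds
   the cost of reading it. *)
have Hwd : size (encode_nat a) <= size (encode_nat (nletters A)).
  by rewrite !size_encode_nat ltnS leq_double leq_width // ltnW.
have Elc : letter_cost = 10 * size (encode_nat (nletters A)) +
  #|{: node A}| * tick_cost A + closure_cost A + 20 by [].
move: Ec1 Ec2 Ec3 Ec4 Hwd Hsz2; ev; rewrite [size (_ :: _)]/= mulSn {}Elc.
move: (size u * letter_cost) (size st.1 * tick_cost A) (#|{: node A}| * tick_cost A).
by move: (size (encode_nat a)) (size (encode_nat (nletters A))) => *; lia.
Qed.

Lemma decide_spec :
  wp decide (init_state (encode_automaton A ++ encode_word w)) (fun s' =>
    ((vars s' v_ans != 0) <-> language A w) /\
    clk s' <= 40 * automaton_size A + 13 * nwatches A + 7 * sumn (betas A) +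
      10 * size (encode_nat (size w)) + 3 * nbits A + closure_cost A +
      size w * letter_cost + 60).
Proof.
apply: wp_seq; apply: wp_mono; first exact: (@parse_spec A).
move=> s1 [HA1 [Fv1 Fa1 Ei1 Ec1]]; apply: wp_seq; apply: wp_mono.
  exact: half_table_spec HA1.
move=> s2 [Hh2 [Fv2 Fa2 Ei2 Ec2]]; apply: wp_seq; apply: wp_mono.
  apply: (@read_nat_spec (size w) _ (encode_nats (map (@nat_of_ord _) w))).
  by rewrite Ei2 Ei1.
move=> s3 [Ev3 [Fv3 Fa3 Ei3 Ec3]]; apply: wp_seq; run.
have HA3 : ready A s3.
  split; last by rewrite /halved; frames.
  by case: HA1 => *; split; frames.
have Est := parsed_start HA3.
apply: wp_seq; apply: wp_mono.
  apply: (@commit_spec A _ 0 1 ([::], false) (initial_node A)).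
  - by apply: (ready_frame HA3); ev; extend_frame.
  - by split; ev; frames.
  (* Fresh memory already holds the zero assignment; only the state of the initial record is
     written. *)
  - apply/holds_cons; ev; frames; split.
      by move: Est; frames.
    rewrite /initial_node /= values_clip => i.
    rewrite size_map size_enum_ord => Hin; pose x := Ordinal Hin.
    by rewrite (nth_map x) ?size_enum_ord // min0n upd_other.
ev; frames => s4 [HL4 [Fv4 Fa4 Ei4 Ec4]].
have Hs4 : sound w 0 (push ([::], false) (initial_node A)).
  by apply: sound_push; [split|exact: ReachInit].
apply: wp_seq; apply: wp_mono.
  apply: (@closure_spec A w 0 _ 0 1 _ _ HL4 Hs4).
  - by apply: (ready_frame HA3); ev; extend_frame.
  - by move=> v ->; exact: covers_push_self.
  - by frames.
move=> s5 [st5 [HL5 Hex5 [Fv5 Fa5 Ei5 Ec5]]].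
apply: wp_seq; apply: wp_mono.
  apply: (@letter_loop_spec w 0 _ 0 st5); rewrite ?drop0 //.
  - by apply: (ready_frame HA3); ev; extend_frame.
  - by frames.
  - by frames; rewrite Ev3 addn0.
  - by rewrite Ei5 Ei4.
move=> s6 [st6 [base6 [HL6 [Hs6 Hc6] Ec6]]]; run; split; last first.
  move: Ec1 Ec2 Ec3 Ec4 Ec5 Ec6; rewrite /init_state; ev; move: letter_cost (closure_cost A) => x1 x2.
  move: (size w * x1) (size (encode_nat _)) => x3 x4; lia.
rewrite reach_language (layer_stamp HL6).
have Hle := layer_hit_le HL6; have Hhit := layer_hit HL6.
(* As [v_hit] is at most the stamp, the inner difference vanishes exactly when acceptance was met in
   the last layer. *)
have -> : (1 - ((size w).+1 - vars s6 v_hit) != 0) = st6.2 by rewrite -Hhit; lia.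
split; first exact: sound_hit Hs6.
by case=> xi /Hc6; rewrite /covers /= eqxx.
Qed.

End Letters.

(** * Cost *)

Section Cost.
Variable A : automaton.

Lemma card_assignment : #|{: assignment A}| = bound A.
Proof.
rewrite card_dep_ffun /bound -big_enum /image_mem; elim: (enum _) => [|x l IH] /=.
  by rewrite big_nil.
by rewrite big_cons IH card_ord.
Qed.

Lemma card_node : #|{: node A}| = nstates A * bound A.
Proof. by rewrite card_prod card_ord card_assignment. Qed.

(** A state lies in one node per assignment, and this count multiplies the stopwatch charge of a
    transition. *)
Lemma sum_source (q : 'I_(nstates A)) :
  \sum_(v : node A) (q == v.1) = bound A.
Proof.
rewrite -(pair_bigA _ (fun q' (xi : assignment A) => nat_of_bool (q == q'))) /=.
rewrite (bigD1 q) //= sum_nat_const card_assignment eqxx muln1.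
rewrite big1 ?addn0 // => q' Nq; rewrite sum_nat_const eq_sym (negPf Nq) muln0 //.
Qed.

Lemma sum_trans_cost ds : \sum_(v : node A) trans_cost v ds =
  80 * (#|{: node A}| * size (flatten (map (@code_transition _ _ _) ds))) +
  30 * (nwatches A * (size ds * bound A)).
Proof.
elim: ds => [|d ds IH].
  by rewrite /trans_cost sum_nat_const /= !muln0.
have -> : flatten (map (@code_transition _ _ _) (d :: ds)) =
  code_transition d ++ flatten (map (@code_transition _ _ _) ds) by [].
rewrite (eq_bigr (fun v : node A => (80 * size (code_transition d) +
  (source d == v.1) * (30 * nwatches A)) + trans_cost v ds)); last by [].
rewrite (size_cat (code_transition d)); move: (size (code_transition d)) IH => z.
move: (size (flatten _)) => y IH.
rewrite big_split IH big_split /= sum_nat_const -big_distrl /= sum_source.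
by set N := #|{: node A}|; nia.
Qed.

Lemma bound_gt0 : 0 < bound A.
Proof. exact: prodn_gt0. Qed.

(** Multiplying out the factors [b.+1] gives 1, the sum of the bounds, and further nonnegative
    terms. The table of halves thus has at most [bound A] entries. *)
Lemma sumn_betas_lt : sumn (betas A) < bound A.
Proof.
rewrite /bound -big_enum /betas; elim: (enum _) => [|x l IH] /=.
  by rewrite big_nil.
rewrite big_cons; move: (\prod_(_ <- _) _) (sumn _) (beta A x) IH => p t b; nia.
Qed.

Lemma size_encode_nats l : size (encode_nats l) = 2 * sumn (map width l) + size l.
Proof.
elim: l => // x l IH; rewrite encode_nats_cons (size_cat (encode_nat x)) IH.
by rewrite size_encode_nat /=; lia.
Qed.

(** A number takes one bit plus two per digit. Counting entries yields the states (through their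
    labels), the stopwatches (through their bounds), the active pairs and the transitions; the
    digits of the bounds yield [nbits A]. *)
Lemma automaton_size_ge :
  nstates A + nwatches A + nbits A + #|active A| + size (code_transitions A) +
  size (encode_nat (nletters A)) <= automaton_size A.
Proof.
rewrite /automaton_size /encode_automaton.
set h := [:: nstates A; nletters A; nwatches A; nat_of_ord (start A); nat_of_ord (accept A)].
have -> : code_automaton A = h ++ labels A ++ betas A ++ [:: #|active A|] ++
  code_pairs A ++ [:: size (transitions A)] ++ code_transitions A by [].
rewrite size_encode_nats size_encode_nat !map_cat !sumn_cat !size_cat /=.
rewrite size_labels size_betas size_code_pairs -/(nbits A) -mul2n.
by move: #|active A| => a; lia.
Qed.

Lemma size_transitions_le : size (transitions A) <= size (code_transitions A).
Proof.
rewrite /code_transitions; elim: (transitions A) => //= d ds IH.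
by rewrite size_cat; lia.
Qed.

(** 141 is 29 + 80 + 30 + 2: the fixed cost per node (8 + 7 + 14), the code of the transitions,
    their stopwatches, and the constant of [closure_cost]. *)
Lemma closure_cost_le : closure_cost A <= 141 * (automaton_size A ^ 2 * bound A).
Proof.
have HS := automaton_size_ge; have HB := bound_gt0; have Ht := size_transitions_le.
rewrite /closure_cost.
rewrite (eq_bigr (fun v : node A => (8 * nbits A + 7 * nwatches A + 14) +
  trans_cost v (transitions A))); last by move=> v _; rewrite /node_cost; lia.
rewrite big_split /= sum_trans_cost sum_nat_const card_node.
have He := size_encode_nat_gt0 (nletters A).
rewrite -/(code_transitions A).
move: #|active A| HS => a.
move: (nstates A) (nwatches A) (nbits A) (bound A) (size (code_transitions A))
  (size (transitions A)) (automaton_size A) (size (encode_nat _)) HB Ht He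
  => q x n B ct t S e HB Ht He HS.
have H1 : q * B <= S * B by rewrite leq_mul2r; lia.
have H2 : S * B <= S ^ 2 * B by rewrite leq_mul2r; nia.
have H3 : q * B * (8 * n + 7 * x + 14) <= S * B * (29 * S) by apply: leq_mul => //; lia.
have H4 : q * B * ct <= S * B * S by apply: leq_mul => //; lia.
have H5 : x * (t * B) <= S * (S * B) by apply: leq_mul; [lia|rewrite leq_mul2r; lia].
have H6 : 0 < S * B by rewrite muln_gt0; lia.
rewrite expnS expn1 in H2 *; nia.
Qed.

(** 273 is 10 + 102 + 141 + 20, where 102 = 3 + 14 + 21 + 64 comes from [tick_cost] and 141 from the
    closure. *)
Lemma letter_cost_le : letter_cost A <= 273 * (automaton_size A ^ 2 * bound A).
Proof.
have HS := automaton_size_ge; have HB := bound_gt0; have Hc := closure_cost_le.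
have He := size_encode_nat_gt0 (nletters A).
rewrite /letter_cost /tick_cost card_node.
move: #|active A| HS => a.
move: (nstates A) (nwatches A) (nbits A) (bound A) (size (code_transitions A))
  (closure_cost A) (automaton_size A) (size (encode_nat _)) HB Hc He
  => q x n B ct cc S e HB Hc He HS.
have H1 : q * B <= S * B by rewrite leq_mul2r; lia.
have H2 : S <= S * S * B by nia.
have H3 : q * B * (3 * n + 14 * x + 21 * a + 64) <= S * B * (102 * S).
  by apply: leq_mul => //; lia.
have H6 : 0 < S * B by rewrite muln_gt0; lia.
rewrite expnS expn1 in Hc *; nia.
Qed.

Lemma size_encode_nat_le n : size (encode_nat n) <= 2 * n + 1.
Proof.
rewrite size_encode_nat -mul2n addn1 ltnS leq_mul2l /=.
by apply: up_log_min => //; exact: ltn_expl.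
Qed.

(** The coefficients add up to 567, rounded up to 600 to take in the two final instructions; 8 is
    the number of instructions per tick. *)
Lemma total_cost_le m :
  8 * (40 * automaton_size A + 13 * nwatches A + 7 * sumn (betas A) +
      10 * size (encode_nat m) + 3 * nbits A + closure_cost A +
      m * letter_cost A + 60) + 2
  <= 8 * 600 * (automaton_size A ^ 2 * bound A * maxn 1 m).
Proof.
have HS := automaton_size_ge; have HB := sumn_betas_lt; have Hc := closure_cost_le.
have Hl := letter_cost_le; have He := size_encode_nat_gt0 (nletters A).
have Hm := size_encode_nat_le m.
set T := automaton_size A ^ 2 * bound A in Hc Hl *.
have HT : automaton_size A <= T.
  rewrite /T expnS expn1 -mulnA leq_pmulr // muln_gt0 bound_gt0 andbT; lia.
have HTB : bound A <= T by rewrite /T leq_pmull // expn_gt0; lia.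
have H1 : m * letter_cost A <= maxn 1 m * (273 * T).
  by apply: leq_mul => //; exact: leq_maxr.
have H2 : T <= T * maxn 1 m by rewrite leq_pmulr // leq_max.
have H3 : maxn 1 m <= T * maxn 1 m by rewrite leq_pmull //; lia.
have H4 : m <= maxn 1 m by exact: leq_maxr.
move: (maxn 1 m) (m * letter_cost A) H1 H2 H3 H4 => M l H1 H2 H3 H4.
rewrite mulnCA in H1; rewrite (mulnC M) in H1.
move: (T * M) H1 H2 H3 => TM H1 H2 H3.
lia.
Qed.

End Cost.

(* [maxn 1 (size w)]: the factor |w| is read as 1 for the empty word. *)
Theorem mainTheorem8 :
  exists (P : program) (c : nat),
    forall (A : automaton) (w : seq 'I_(nletters A)),
    exists b : bool,
      run P (c * (automaton_size A ^ 2 * bound A * maxn 1 (size w)))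
          (initial_config (encode_automaton A ++ encode_word w)) = Some b
      /\ (b <-> language A w).
Proof.
exists (compile_program decide), (8 * 600) => A w.
have [s' He [Hb Hc]] := decide_spec w.
exists (vars s' 0 != 0); split=> //.
apply: (compile_program_correct _ He) => //.
by apply: leq_trans (total_cost_le A (size w)); lia.
Qed.
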